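(* Assume $t_0>0$, $\alpha>3$; $\xi:[t_0,+\infty)\to(0,+\infty)$ is a differentiable function for which there exist $t_1'\ge t_0$ and a (sufficiently small) constant $\delta>0$ such that $$\Big(2-\frac{2\alpha}{3}\Big)+t\,\frac{\dot\xi(t)}{\xi(t)}<-\delta\qquad\text{for all } t\ge t_1';$$ and $\epsilon$ is a continuously differentiable nonincreasing function such that there exist $M>1$ and $t_1'\ge t_0$ with $$2\dot\epsilon(t)+M\Big|\gamma+\frac{\beta}{t}\Big|\,\xi(t)\,\epsilon(t)^2\le 0\qquad\text{for all } t\ge t_1'.$$ Suppose moreover that $\int_{t_0}^{+\infty}\frac{\xi(t)\epsilon(t)}{t}\,dt<+\infty$ and that $$\lim_{t\to+\infty}t^2\xi(t)\epsilon(t)=+\infty,\qquad \liminf_{t\to+\infty}\xi(t)\ne0,\qquad \lim_{t\to+\infty}\frac{1}{t^2\xi(t)\epsilon(t)}\int_{t_0}^t s^2\xi(s)^2\epsilon(s)^2\,ds=0 .$$ Let $(x(\cdot),\lambda(\cdot))$ be a global solution of the dynamical system (PDDS-IHDTR) described in the context, and let $x^*=\mathrm{Proj}_S 0$ be the minimum-norm element of the solution set $S$. Then $$\liminf_{t\to+\infty}\|x(t)-x^*\|=0 .$$ Moreover, if there exists a large enough $T$ such that the trajectory $\{x(t):t\ge T\}$ stays in either the open ball $B(0,\|x^*\|)$ or its complement, then $$\lim_{t\to+\infty}\|x(t)-x^*\|=0 .$$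
   Context: $\mathcal{X},\mathcal{Y}$ are real Hilbert spaces, $f:\mathcal{X}\to\mathbb{R}$ is convex and continuously differentiable, $A:\mathcal{X}\to\mathcal{Y}$ is a continuous linear operator with adjoint $A^T$, $b\in\mathcal{Y}$. The problem is $\min_{x\in\mathcal{X}} f(x)$ subject to $Ax=b$, and $S$ denotes its set of solutions; $\mathrm{Proj}_S$ is the metric projection onto the closed convex set $S$. The Lagrangian is $\mathcal{L}(x,\lambda)=f(x)+\langle\lambda,Ax-b\rangle$ and the augmented Lagrangian is $\mathcal{L}_\rho(x,\lambda)=\mathcal{L}(x,\lambda)+\frac{\rho}{2}\|Ax-b\|^2$ with a fixed $\rho>0$; thus $\nabla_x\mathcal{L}_\rho(x,\lambda)=\nabla f(x)+A^T\lambda+\rho A^T(Ax-b)$ and $\nabla_\lambda\mathcal{L}_\rho(x,\lambda)=Ax-b$. $\Omega$ is the set of saddle points of $\mathcal{L}$, i.e. the pairs $(x^*,\lambda^* )\in\mathcal{X}\times\mathcal{Y}$ with $\mathcal{L}(x^*,\lambda)\le\mathcal{L}(x^*,\lambda^* )\le\mathcal{L}(x,\lambda^* )$ for all $(x,\lambda)$. It is assumed that $\Omega\ne\emptyset$. Dynamical system (PDDS-IHDTR), for $t\ge t_0>0$ and $\alpha>0$: $$\ddot x(t)+\frac{\alpha}{t}\dot x(t)+\xi(t)\big(\nabla_x\mathcal{L}_\rho(\hat x(t),\bar\lambda(t))+\epsilon(t)x(t)\big)=0,$$ $$\ddot\lambda(t)+\frac{\alpha}{t}\dot\lambda(t)-\xi(t)\Big(\nabla_\lambda\mathcal{L}_\rho(\bar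 x(t),\lambda(t))+\eta(t)A\dot x(t)-\frac{3}{2\alpha}t\,\xi(t)\beta(t)\,A\big(\nabla_x\mathcal{L}_\rho(\hat x(t),\bar\lambda(t))+\epsilon(t)x(t)\big)\Big)=0,$$ where $\beta(t)=\gamma+\frac{\beta}{t}$ with constants satisfying either $\gamma>0,\ \beta\in\mathbb{R}$, or $\gamma=0,\ \beta\ge0$; $\hat x(t)=x(t)+\beta(t)\dot x(t)$; $\bar x(t)=x(t)+\frac{3}{2\alpha}t\dot x(t)$; $\bar\lambda(t)=\lambda(t)+\frac{3}{2\alpha}t\dot\lambda(t)$; $\eta(t)=\frac{1}{2\alpha}(-\alpha\beta(t)+3t\dot\beta(t))$; $\xi:[t_0,+\infty)\to(0,+\infty)$ is continuous; and $\epsilon:[t_0,+\infty)\to\mathbb{R}_+=[0,+\infty)$ is a $\mathcal{C}^1$ nonincreasing function with $\lim_{t\to+\infty}\epsilon(t)=0$. A (global) solution is a pair of twice differentiable functions $x:[t_0,+\infty)\to\mathcal{X}$, $\lambda:[t_0,+\infty)\to\mathcal{Y}$ satisfying both equations for all $t\ge t_0$. *)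

(* Defs.v *)
From HB Require Import structures.
From mathcomp Require Import all_boot all_order all_algebra sesquilinear.
From mathcomp Require Import all_classical all_reals all_analysis.

Set Implicit Arguments.
Unset Strict Implicit.
Unset Printing Implicit Defensive.
Import Order.TTheory GRing.Theory Num.Theory.
Import numFieldNormedType.Exports.
Local Open Scope classical_set_scope.
Local Open Scope ring_scope.

Section DomainDerivative.
Context {R : realType} {V : normedModType R}.
Implicit Types (D : set R) (u : R -> V) (t : R).

(* Same difference quotient as [derivable] and [derive1], but with increments
   that stay in D; at the left endpoint of `[t0, +oo[ the derivative is thus
   one-sided, and values of u outside D are irrelevant. *)
Definition derivable_on D u t : Prop :=
  cvg ((fun h => h^-1 *: (u (h + t) - u t)) @ within [set h | D (h + t)] 0^').

Definition derive_on D u t : V :=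
  lim ((fun h => h^-1 *: (u (h + t) - u t)) @ within [set h | D (h + t)] 0^').

Definition C1_on D u : Prop :=
  (forall t, D t -> derivable_on D u t) /\ {within D, continuous (derive_on D u)}.

Definition twice_derivable_on D u : Prop :=
  forall t, D t -> derivable_on D u t /\ derivable_on D (derive_on D u) t.

End DomainDerivative.

(* A real Hilbert space is a complete normed module whose norm is induced by an
   inner product. *)
Definition hilbert_ip (R : realType) (X : completeNormedModType R)
    (ip : {dot X for idfun}) : Prop :=
  forall x : X, `|x| ^+ 2 = ip x x.

Definition is_gradient (R : realType) (X : completeNormedModType R)
    (ip : {dot X for idfun}) (f : X -> R) (grad : X -> X) : Prop :=
  forall x, differentiable f x /\ forall h, 'd f x h = ip (grad x) h.

Definition is_adjoint (R : realType) (X Y : completeNormedModType R)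
    (ipX : {dot X for idfun}) (ipY : {dot Y for idfun})
    (A : X -> Y) (AT : Y -> X) : Prop :=
  forall x y, ipY (A x) y = ipX x (AT y).

Definition is_proj (R : realType) (X : normedModType R) (S : set X) (z p : X) : Prop :=
  S p /\ forall y, S y -> `|z - p| <= `|z - y|.

Section Problem.
Context {R : realType} {X Y : completeNormedModType R}.
Variables (ipY : {dot Y for idfun}) (f : X -> R) (A : X -> Y) (b : Y).

Definition solution_set : set X :=
  [set x | A x = b /\ forall y, A y = b -> f x <= f y].

Definition lagrangian (x : X) (l : Y) : R := f x + ipY l (A x - b).

Definition saddle_points : set (X * Y) :=
  [set p | forall x l, lagrangian p.1 l <= lagrangian p.1 p.2 /\
                       lagrangian p.1 p.2 <= lagrangian x p.2].

End Problem.

Section Dynamics.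
Context {R : realType} {X Y : completeNormedModType R}.
Variables (gradf : X -> X) (A : X -> Y) (AT : Y -> X) (b : Y).
Variables (rho t0 alpha gamma beta : R) (xi eps : R -> R).

(* The partial gradients of f x + <l, A x - b> + rho / 2 * |A x - b|^2. *)
Definition grad_x_Lrho (x : X) (l : Y) : X :=
  gradf x + AT l + rho *: AT (A x - b).

Definition grad_l_Lrho (x : X) (l : Y) : Y := A x - b.

Definition beta_fun (t : R) : R := gamma + beta / t.

Definition eta_fun (t : R) : R :=
  (2 * alpha)^-1 * (- alpha * beta_fun t + 3 * t * derive1 beta_fun t).

Definition is_PDDS_solution (x : R -> X) (l : R -> Y) : Prop :=
  let D := `[t0, +oo[%classic in
  let dx := derive_on D x in
  let dl := derive_on D l in
  let ddx := derive_on D dx in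
  let ddl := derive_on D dl in
  let xhat t := x t + beta_fun t *: dx t in
  let xbar t := x t + (3 / (2 * alpha) * t) *: dx t in
  let lbar t := l t + (3 / (2 * alpha) * t) *: dl t in
  let G t := grad_x_Lrho (xhat t) (lbar t) + eps t *: x t in
  [/\ twice_derivable_on D x, twice_derivable_on D l &
      forall t, t0 <= t ->
        ddx t + (alpha / t) *: dx t + xi t *: G t = 0 /\
        ddl t + (alpha / t) *: dl t
          - xi t *: (grad_l_Lrho (xbar t) (l t) + eta_fun t *: A (dx t)
                     - (3 / (2 * alpha) * t * xi t * beta_fun t) *: A (G t)) = 0].

End Dynamics.

(* Main.v *)
(* Let L be the augmented Lagrangian and ls a multiplier of xs = Proj_S 0; write
   gap z = L(z, ls) - L(xs, ls) >= 0, y = x + beta(t) x', kap = 2 alpha / 3,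
   v = kap (x - xs) + t x', w = kap (l - ls) + t l'.  The correction terms of the
   second equation turn it into l'' + (alpha / t) l' = xi (A (y + (t / kap) y') - b),
   so y is the natural primal variable: in the derivative of
     E = t^2 xi (gap y + eps |x|^2 / 2) + |v|^2 / 2 + |w|^2 / 2
         + kap (alpha / 3 - 1) / 2 * (|x - xs|^2 + |l - ls|^2)
   all primal-dual cross terms cancel, and the condition on eps' absorbs the term
   beta t^2 xi^2 eps^2 |x|^2.  This leaves E' <= kap t xi eps |xs|^2 / 2, and
   Kronecker's lemma gives E = o(t^2), hence gap y -> 0 and y - x -> 0, because xi
   is bounded below.  Sublevel sets of gap shrink to S, so points with small gap
   and with norm at most |xs| + o(1) are close to xs (the parallelogram identity
   makes near-minimizers of the norm Cauchy; no weak compactness is needed).  It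
   remains to control |x|: inside the ball nothing is needed, and if |x| >= |xs|
   eventually, then measuring the Tikhonov term from |xs|^2 leaves only a source of
   order t^2 xi^2 eps^2, so |x|^2 - |xs|^2 -> 0.  If neither holds, x enters the
   ball at arbitrarily large times, which gives the liminf. *)

Require Import Defs.
From HB Require Import structures.
From mathcomp Require Import all_boot all_order all_algebra sesquilinear.
From mathcomp Require Import all_classical all_reals all_analysis.
From mathcomp Require Import measurable_realfun ring lra.

Import Order.TTheory GRing.Theory Num.Theory.
Import numFieldNormedType.Exports.
Local Open Scope classical_set_scope.
Local Open Scope ring_scope.

(** * Derivatives along real time and inner products *)

Lemma is_derive_quotP (R : realType) (V : normedModType R) (u : R -> V) (t : R)
    (du : V) :
  is_derive t 1 u du <-> h^-1 *: (u (h + t) - u t) @[h --> 0^'] --> du.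
Proof.
have E : (fun h : R => h^-1 *: ((u \o shift t) (h *: 1) - u t)) =
         (fun h => h^-1 *: (u (h + t) - u t)).
  by apply/funext => h /=; rewrite /GRing.scale /= mulr1.
split => [[]|cu].
  by rewrite /derivable /derive E => + <-.
split; rewrite /derivable /derive E; first by apply/cvg_ex; exists du.
exact/cvg_lim.
Qed.

Lemma is_derive_cvg_shift (R : realType) (V : normedModType R) (u : R -> V)
    (t : R) (du : V) : is_derive t 1 u du -> u (h + t) @[h --> (0 : R)^'] --> u t.
Proof.
move=> /is_derive_quotP cu.
have : h *: (h^-1 *: (u (h + t) - u t)) + u t @[h --> (0 : R)^']
      --> 0 *: du + u t.
  apply: cvgD; last exact: cvg_cst.
  by apply: cvgZ => //; exact: nbhs_dnbhs.
rewrite scale0r add0r; apply: cvg_trans; apply: near_eq_cvg.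
near=> h; rewrite /= scalerA mulfV ?scale1r ?subrK //.
near: h; exact: nbhs_dnbhs_neq.
Unshelve. all: by end_near. Qed.

(** At an interior point all small increments stay in the half-line, so the restricted filter
    coincides with [0^']. This is why the energy estimates are made for [t0 < t] only. *)
Lemma is_derive_derive_on (R : realType) (V : normedModType R) (u : R -> V)
    (t0 t : R) : t0 < t -> derivable_on `[t0, +oo[ u t ->
  is_derive t 1 u (derive_on `[t0, +oo[ u t).
Proof.
move=> t0t du; apply/is_derive_quotP.
suff F : within [set h | `[t0, +oo[%classic (h + t)] (0 : R)^' = (0 : R)^'.
  by move: du; rewrite /derivable_on /derive_on F.
apply/seteqP; split => P; last exact: cvg_within.
rewrite /within /= => nP.
have : \forall h \near (0 : R), `[t0, +oo[%classic (h + t).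
  near=> h; rewrite /= in_itv /= andbT -lerBlDr.
  by apply/ltW; near: h; apply: lt_nbhsr; rewrite subr_lt0.
move=> nI; near=> h; have := near nP h; apply => //.
by near: h; apply: nbhs_dnbhs.
Unshelve. all: by end_near. Qed.

(** Near [t] the difference quotients are bounded by [|a| + 1], so increments within [D] are at most
    [(|a| + 1) * |s - t|]. *)
Lemma derivable_on_within_continuous (R : realType) (V : normedModType R)
    (D : set R) (u : R -> V) :
  (forall t, D t -> derivable_on D u t) -> {within D, continuous u}.
Proof.
move=> du; apply/subspace_continuousP => t Dt.
have /cvg_ex[/= a] := du t Dt.
move=> /cvgrPdist_lt /(_ 1 ltr01); rewrite !near_withinE => -[/= d d0 dP].
apply/cvgrPdist_lt => e e0; rewrite near_withinE.
have a1 : 0 < `|a| + 1 by rewrite ltr_wpDl.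
exists (Num.min d (e / (`|a| + 1))); first by rewrite /= lt_min d0 divr_gt0.
move=> s; rewrite /= lt_min => /andP[sd se] Ds.
have [->|st] := eqVneq s t; first by rewrite subrr normr0.
have st0 : s - t != 0 by rewrite subr_eq0.
have := dP (s - t); rewrite /= sub0r normrN distrC subrK => /(_ sd st0 Ds) q.
have {}q : `|(s - t)^-1 *: (u s - u t)| < `|a| + 1.
  have := lerB_dist ((s - t)^-1 *: (u s - u t)) a; rewrite distrC; lra.
rewrite distrC -[u s - u t](scalerKV st0) normrZ distrC.
rewrite ltr_pdivlMr // in se; apply: le_lt_trans se.
by rewrite ler_wpM2l // ltW.
Qed.

Lemma le_of_derive_le0 (R : realType) (F : R -> R) (s t : R) : s <= t ->
  (forall r, s <= r <= t -> exists dF, is_derive r 1 F dF /\ dF <= 0) -> F t <= F s.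
Proof.
move=> st FdF; have := ler0_derive1_nincr (f := F) (a := s) (b := t).
have sub r : r \in `]s, t[ -> s <= r <= t.
  by rewrite in_itv /= => /andP[/ltW -> /ltW ->].
apply => //.
- by move=> r /sub/FdF[d [[]]].
- by move=> r /sub/FdF[d [[_]]]; rewrite derive1E => ->.
- by apply: derivable_within_continuous => r; rewrite in_itv /= => /FdF[d [[]]].
Qed.

(** * Inner products: bilinear expansion, continuity and product rule *)

Section Hilbert.
Context {R : realType} {X : completeNormedModType R}.
Variables (ip : {dot X for idfun}).
Hypothesis HX : hilbert_ip ip.

Lemma ipC (x y : X) : ip x y = ip y x.
Proof. by rewrite hermC /= expr0 mul1r. Qed.
Lemma ipDl (x y z : X) : ip (x + y) z = ip x z + ip y z.
Proof. exact: linearDl. Qed.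
Lemma ipDr (x y z : X) : ip z (x + y) = ip z x + ip z y.
Proof. exact: linearDr. Qed.
Lemma ipNl (x z : X) : ip (- x) z = - ip x z.
Proof. exact: linearNl. Qed.
Lemma ipNr (x z : X) : ip z (- x) = - ip z x.
Proof. exact: linearNr. Qed.
Lemma ipZl (a : R) (x z : X) : ip (a *: x) z = a * ip x z.
Proof. exact: linearZl_LR. Qed.
Lemma ipZr (a : R) (x z : X) : ip z (a *: x) = a * ip z x.
Proof. exact: linearZr_LR. Qed.

Definition ipE := (ipDl, ipDr, ipNl, ipNr, ipZl, ipZr).

(** Polarization: joint continuity of the inner product is reduced to continuity of the norm. *)
Lemma ip_polar (x y : X) : ip x y = (`|x + y| ^+ 2 - `|x - y| ^+ 2) / 4.
Proof. by rewrite !HX !ipE (ipC y x); field. Qed.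

Lemma ip_ge0 (x : X) : 0 <= ip x x.
Proof. by rewrite -HX sqr_ge0. Qed.

Lemma cvg_ip (T : Type) (F : set_system T) (FF : Filter F) (u v : T -> X) (a b : X) :
  u @ F --> a -> v @ F --> b -> ip (u t) (v t) @[t --> F] --> ip a b.
Proof.
move=> ua vb; rewrite ip_polar (_ : (fun _ => _) =
    fun t => (`|u t + v t| ^+ 2 - `|u t - v t| ^+ 2) / 4); last first.
  by apply/funext => t; rewrite ip_polar.
apply: cvgMl; apply: cvgB; apply: cvgM; apply: cvg_norm;
  by [exact: cvgD | exact: cvgB].
Qed.

Lemma is_derive_ip (u v : R -> X) (t : R) (du dv : X) :
  is_derive t 1 u du -> is_derive t 1 v dv ->
  is_derive t 1 (fun s => ip (u s) (v s)) (ip du (v t) + ip (u t) dv).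
Proof.
move=> Du Dv; apply/is_derive_quotP.
have vc := is_derive_cvg_shift _ _ _ _ _ Dv.
move/is_derive_quotP : Du => Du; move/is_derive_quotP : Dv => Dv.
have : ip (h^-1 *: (u (h + t) - u t)) (v (h + t))
       + ip (u t) (h^-1 *: (v (h + t) - v t)) @[h --> (0 : R)^']
    --> ip du (v t) + ip (u t) dv.
  by apply: cvgD; apply: cvg_ip => //; exact: cvg_cst.
apply: cvg_trans; apply: near_eq_cvg; near=> h.
by rewrite !ipE /GRing.scale /=; ring.
Unshelve. all: by end_near. Qed.

End Hilbert.

Lemma is_derive_continuous_linear (R : realType) (X Y : normedModType R)
    (A : {linear X -> Y}) (u : R -> X) (t : R) (du : X) :
  continuous A -> is_derive t 1 u du -> is_derive t 1 (A \o u) (A du).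
Proof.
move=> cA /is_derive_quotP Du; apply/is_derive_quotP.
have := cvg_comp _ _ Du (cA du); apply: cvg_trans; apply: near_eq_cvg.
by near=> h; rewrite /= linearZ linearB.
Unshelve. all: by end_near. Qed.

(** * Chain rule and tangent inequality for the objective *)

Section Gradient.
Context {R : realType} {X : completeNormedModType R}.
Variables (ip : {dot X for idfun}) (f : X -> R) (gradf : X -> X).
Hypothesis fgrad : is_gradient ip f gradf.

Lemma is_derive_gradient (u : R -> X) (t : R) (du : X) :
  is_derive t 1 u du -> is_derive t 1 (f \o u) (ip (gradf (u t)) du).
Proof.
move=> [Du duE]; have [df dfE] := fgrad (u t).
have dut : differentiable u t by exact/derivable1_diffP.
have dfu : differentiable (f \o u) t by exact: differentiable_comp.
split; first exact/derivable1_diffP.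
have duE' : 'd u t 1 = du by rewrite -deriveE.
by rewrite deriveE // diff_comp //= duE' dfE.
Qed.

(** Convexity on the segment bounds the quotients with [0 < h <= 1] by [f y - f x]; the bound
    survives the limit from the right. *)
Lemma convex_gradient_le (x y : X) : convex_function [set: X] f ->
  f x + ip (gradf x) (y - x) <= f y.
Proof.
move=> cf; have [df dfE] := fgrad x.
have D : derivable f x (y - x) by exact: diff_derivable.
have /cvg_dnbhs_at_right cD : h^-1 *: (f (h *: (y - x) + x) - f x) @[h --> (0 : R)^']
    --> ip (gradf x) (y - x) by rewrite -dfE -deriveE //; exact: D.
rewrite -lerBrDl -(cvg_lim _ cD) //; apply: limr_le.
  by apply/cvg_ex; eexists; exact: cD.
near=> h.
have h0 : 0 < h by [].
have h1 : h <= 1 by near: h; exact: nbhs_right_le.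
have : f (h *: y + (1 - h) *: x) <= h * f y + (1 - h) * f x :=
  cf (Itv01 (ltW h0) h1) y x (mem_set I) (mem_set I).
have -> : h *: y + (1 - h) *: x = h *: (y - x) + x.
  by rewrite scalerBr scalerBl scale1r addrA addrAC.
move=> hle; rewrite /GRing.scale /= ler_pdivrMl //; lra.
Unshelve. all: by end_near. Qed.

End Gradient.

(** * Approximate minimal-norm points *)

Section MinNorm.
Context {R : realType} {X : completeNormedModType R}.
Variable (ip : {dot X for idfun}).
Hypothesis HX : hilbert_ip ip.

Lemma parallelogram (a b : X) :
  `|a - b| ^+ 2 = 2 * `|a| ^+ 2 + 2 * `|b| ^+ 2 - 4 * `|2^-1 *: (a + b)| ^+ 2.
Proof. by rewrite !HX !(ipE ip) (ipC ip b a); field. Qed.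

(** Points of a small sublevel set whose norm is nearly minimal there form a set of small diameter,
    by the parallelogram identity and [mid]. These sets generate a Cauchy filter; its limit is
    feasible, so the limiting minimal norm equals [|p|]. Then [p] lies in all of them and the
    diameter bound gives the claim. *)
Lemma min_norm_stable (Phi : X -> R) (p : X) :
  continuous Phi ->
  (forall a b c, Phi a <= c -> Phi b <= c -> Phi (2^-1 *: (a + b)) <= c) ->
  Phi p <= 0 -> (forall y, Phi y <= 0 -> `|p| <= `|y|) ->
  forall e, 0 < e -> exists2 tau, 0 < tau &
    forall y, Phi y <= tau -> `|y| <= `|p| + tau -> `|y - p| < e.
Proof.
move=> cPhi mid p0 pmin.
(* [D] is the limit, as [tau] decreases to 0, of the infimum of the norm over [Phi <= tau]. *)
pose L := [set c : R | exists2 tau, 0 < tau & forall y, Phi y <= tau -> c <= `|y|].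
pose D := sup L.
have Lp c : L c -> c <= `|p|.
  by move=> [tau tau0]; apply; exact: le_trans (ltW tau0).
have L0 : L 0 by exists 1.
have supL : has_sup L by split; [exists 0|exists `|p| => c /Lp].
have D0 : 0 <= D by exact: ub_le_sup supL.2 _ L0.
have Dp : D <= `|p| by apply: ge_sup => //; exists 0.
pose B tau := [set y | Phi y <= tau /\ `|y| <= D + tau].
pose F := filter_from [set tau : R | 0 < tau] B.
have B_neq0 tau : 0 < tau -> B tau !=set0.
  (* If [B tau] were empty, [D + tau] would belong to [L], above its supremum. *)
  move=> tau0; apply: contrapT => Bn.
  suff : D + tau <= D by lra.
  apply: (ub_le_sup supL.2); exists tau => // y ytau; rewrite leNgt; apply/negP.
  by move=> ylt; apply: Bn; exists y; split => //; exact: ltW.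
have FF : ProperFilter F.
  apply: filter_from_proper => //; apply: filter_from_filter; first by exists 1 => /=.
  move=> s t /= s0 t0; exists (Num.min s t); first by rewrite /= lt_min s0.
  move=> y [/= yP yn]; split; split.
  - by apply: le_trans yP _; rewrite ge_min lexx.
  - by apply: le_trans yn _; rewrite lerD2l ge_min lexx.
  - by apply: le_trans yP _; rewrite ge_min lexx orbT.
  - by apply: le_trans yn _; rewrite lerD2l ge_min lexx orbT.
have Bdiam e : 0 < e -> exists2 tau, 0 < tau &
    forall a b, B tau a -> B tau b -> `|a - b| < e.
  (* The parallelogram identity gives [|a - b|^2 <= 4 (D + s)^2 - 4 (D^2 - 2 D s) = 16 D s + 4 s^2],
     which is below [(16 D + 5) s] because [0 < s <= 1]. *)
  move=> e0; pose s := Num.min 1 (e ^+ 2 / (16 * D + 5)).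
  have den0 : 0 < 16 * D + 5 by lra.
  have s0 : 0 < s by rewrite lt_min ltr01 divr_gt0 // exprn_gt0.
  have s1 : s <= 1 by rewrite ge_min lexx.
  have se : (16 * D + 5) * s <= e ^+ 2.
    by rewrite mulrC -ler_pdivlMr // ge_min lexx orbT.
  have [c [tau tau0 ctau] Dc] := sup_adherent s0 supL.
  exists (Num.min tau s); first by rewrite lt_min tau0.
  move=> a b [aP an] [bP bn].
  have mP : Phi (2^-1 *: (a + b)) <= tau.
    by apply: le_trans (mid _ _ _ aP bP) _; rewrite ge_min lexx.
  have := ctau _ mP; have := parallelogram a b.
  have as_ : `|a| <= D + s by apply: le_trans an _; rewrite lerD2l ge_min lexx orbT.
  have bs_ : `|b| <= D + s by apply: le_trans bn _; rewrite lerD2l ge_min lexx orbT.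
  have a2 : `|a| ^+ 2 <= (D + s) ^+ 2 by rewrite lerXn2r ?nnegrE // addr_ge0 // ltW.
  have b2 : `|b| ^+ 2 <= (D + s) ^+ 2 by rewrite lerXn2r ?nnegrE // addr_ge0 // ltW.
  set m := `|2^-1 *: (a + b)|; move=> par cm.
  have m0 : 0 <= m by exact: normr_ge0.
  have m2 : D ^+ 2 - 2 * D * s <= m ^+ 2.
    have [Ds|sD] := leP D s; first by have := sqr_ge0 m; nra.
    by have Dsm : D - s <= m := ltW (lt_le_trans Dc cm); nra.
  rewrite -(@ltr_pXn2r _ 2) ?nnegrE // ?ltW // par.
  by apply: lt_le_trans se; nra.
have /cauchy_cvg cF : cauchy F.
  apply/cauchy_ballP => e e0; have [tau tau0 Bt] := Bdiam e e0.
  exists (B tau, B tau); first by split; exists tau.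
  by move=> [a b] [/= Ba Bb]; rewrite -ball_normE /=; exact: Bt.
set z := lim F in cF *.
have Fz : F --> z by [].
have zP : Phi z <= 0.
  apply/ler_addgt0Pr => e e0; rewrite add0r.
  have cz : Phi y @[y --> F] --> Phi z := cvg_trans (cvg_app Phi Fz) (cPhi z).
  rewrite -(cvg_lim _ cz) //; apply: limr_le; first by apply/cvg_ex; eexists; exact: cz.
  by exists e => // y [].
have zn : `|z| <= D.
  apply/ler_addgt0Pr => e e0.
  have cz : `|y| @[y --> F] --> `|z| :=
    cvg_trans (cvg_app (fun y => `|y|) Fz) (@norm_continuous _ _ z).
  rewrite -(cvg_lim _ cz) //; apply: limr_le; first by apply/cvg_ex; eexists; exact: cz.
  by exists e => // y [].
(* Feasibility of the limit gives [|p| <= |z| <= D], the converse of [Dp]. *)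
have DE : D = `|p| by apply/eqP; rewrite eq_le Dp (le_trans (pmin z zP)).
move=> e e0; have [tau tau0 Bt] := Bdiam e e0; exists tau => // y yP yn.
apply: Bt; split; rewrite ?DE //; first exact: le_trans (ltW tau0).
by rewrite lerDl ltW.
Qed.

End MinNorm.

(** * Integrals and lower limits *)

Section Integral.
Context {R : realType}.
Implicit Types (g u : R -> R).
Local Notation mu := (@lebesgue_measure R).

Lemma within_continuous_integrable g (t0 t : R) :
  {within `[t0, +oo[, continuous g} -> mu.-integrable `[t0, t] (EFin \o g).
Proof.
move=> cg; apply: continuous_compact_integrable; first exact: segment_compact.
apply: continuous_subspaceW cg => s /=; rewrite !in_itv /= andbT.
by move=> /andP[].
Qed.

Lemma is_derive_Rintegral g (t0 t : R) : {within `[t0, +oo[, continuous g} ->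
  t0 < t ->
  is_derive t 1 (fun t => \int[mu]_(s in `[t0, t]) g s) (g t).
Proof.
move=> cg t0t; have tt1 : t < t + 1 by rewrite ltrDl.
have cgt : {for t, continuous g}.
  by have /continuous_within_itvcyP[+ _] := cg; apply; rewrite in_itv /= t0t.
have [dI IE] := continuous_FTC1_closed tt1
  (within_continuous_integrable _ _ _ cg) t0t cgt.
by split; [exact: dI|rewrite -derive1E; exact: IE].
Qed.

Lemma Rintegral_bounded g (t0 : R) : {within `[t0, +oo[, continuous g} ->
  (forall t, t0 <= t -> 0 <= g t) ->
  (\int[mu]_(t in `[t0, +oo[) (g t)%:E < +oo)%E ->
  exists B, forall t, \int[mu]_(s in `[t0, t]) g s <= B.
Proof.
move=> cg g0 gfin.
have I0 t : (0 <= \int[mu]_(s in `[t0, t]) (g s)%:E)%E.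
  apply: integral_ge0 => s /=; rewrite in_itv /= lee_fin => /andP[t0s _].
  exact: g0.
have It t : (\int[mu]_(s in `[t0, t]) (g s)%:E <= \int[mu]_(s in `[t0, +oo[) (g s)%:E)%E.
  apply: ge0_subset_integral => //.
    by apply/measurable_EFinP; exact: subspace_continuous_measurable_fun.
    by move=> s /=; rewrite in_itv /= andbT lee_fin; exact: g0.
  by move=> s /=; rewrite !in_itv /= andbT => /andP[].
exists (fine (\int[mu]_(s in `[t0, +oo[) (g s)%:E)) => t.
have fin : (\int[mu]_(s in `[t0, +oo[) (g s)%:E)%E \is a fin_num.
  by rewrite ge0_fin_numE // (le_trans (I0 t0)).
rewrite /Rintegral; apply: fine_le => //.
by rewrite ge0_fin_numE // (le_lt_trans (It t)).
Qed.

(** Every neighbourhood of infinity contains a ray, on which [u] takes arbitrarily small values; the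
    ray from [T0] supplies the lower bound 0. *)
Lemma limf_einf_eq0 u (T0 : R) : (forall t, T0 <= t -> 0 <= u t) ->
  (forall e T, 0 < e -> exists2 t, T <= t & u t < e) ->
  limf_einf (fun t => (u t)%:E) (+oo : set_system R) = 0%E.
Proof.
move=> u0 small; rewrite limf_einfE; apply/eqP; rewrite eq_le; apply/andP; split.
  apply: ub_ereal_sup => _ [V [M [Mr MV]] <-].
  apply/lee_addgt0Pr => e e0; rewrite add0e.
  have [t Mt ut] := small e (M + 1) e0.
  apply: (@le_trans _ _ (u t)%:E); last by rewrite lee_fin ltW.
  apply: ereal_inf_lbound; exists t => //; apply: MV.
  by apply: lt_le_trans Mt; rewrite ltrDl.
apply: (@le_trans _ _ (ereal_inf ((fun t => (u t)%:E) @` [set t | T0 <= t]))).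
  by apply: le_ereal_inf_tmp => _ [t /= Tt <-]; rewrite lee_fin u0.
apply: ereal_sup_ubound; exists [set t | T0 <= t] => //.
exact: nbhs_pinfty_ge (num_real _).
Qed.

Lemma liminf_neq0_bounded_below u (t0 : R) : (forall t, t0 <= t -> 0 < u t) ->
  limf_einf (fun t => (u t)%:E) (+oo : set_system R) <> 0%E ->
  exists c T, 0 < c /\ forall t, T <= t -> c <= u t.
Proof.
move=> u0 ne; apply: contrapT => small; apply: ne.
apply: (limf_einf_eq0 _ t0) => [t /u0/ltW //|e T e0].
apply: contrapT => big; apply: small; exists e, T; split => // t Tt.
by rewrite leNgt; apply/negP => ute; apply: big; exists t.
Qed.

End Integral.

(** * Derivative rules for pointwise expressions *)

Section DeriveLambda.
Context {R : realType} {V : normedModType R}.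
Implicit Types (a : R -> R) (u v : R -> V) (t : R).

Lemma is_derive_add u v t (du dv : V) : is_derive t 1 u du ->
  is_derive t 1 v dv -> is_derive t 1 (fun s => u s + v s) (du + dv).
Proof. exact: is_deriveD. Qed.

Lemma is_derive_subc u t (du p : V) : is_derive t 1 u du ->
  is_derive t 1 (fun s => u s - p) du.
Proof. by move=> Du; rewrite -[du]addr0; apply: is_derive_add. Qed.

Lemma is_derive_scale a u t (da : R) (du : V) :
  is_derive t 1 a da -> is_derive t 1 u du ->
  is_derive t 1 (fun s => a s *: u s) (da *: u t + a t *: du).
Proof.
move=> Da Du; have uc := is_derive_cvg_shift _ _ _ _ _ Du.
move/is_derive_quotP : Da => Da; move/is_derive_quotP : Du => Du.
apply/is_derive_quotP.
have : (h^-1 * (a (h + t) - a t)) *: u (h + t)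
    + a t *: (h^-1 *: (u (h + t) - u t)) @[h --> (0 : R)^'] --> da *: u t + a t *: du.
  by apply: cvgD; apply: cvgZ => //; exact: cvg_cst.
apply: cvg_trans; apply: near_eq_cvg; near=> h => /=.
rewrite !scalerBr -!scalerA scalerBl !scalerBr.
by rewrite !(scalerA _ h^-1) (mulrC (a t)) -!scalerA addrA subrK.
Unshelve. all: by end_near. Qed.

Lemma is_derive_mul (a c : R -> R) t (da dc : R) :
  is_derive t 1 a da -> is_derive t 1 c dc ->
  is_derive t 1 (fun s => a s * c s) (da * c t + a t * dc).
Proof.
move=> Da Dc; apply: (is_derive_eq (is_deriveM Da Dc)).
by rewrite /GRing.scale /=; ring.
Qed.

End DeriveLambda.

(* Kronecker's lemma: [J] plays the role of the convergent integral of [g]. *)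
Lemma kronecker_bound (R : realType) (E J g : R -> R) (C B T : R) :
  0 < T -> 0 <= C ->
  (forall t, T <= t -> 0 <= g t) ->
  (forall t, T <= t -> is_derive t 1 J (g t)) ->
  (forall t, T <= t -> J t <= B) ->
  (forall t, T <= t -> exists dE, is_derive t 1 E dE /\ dE <= C * (t ^+ 2 * g t)) ->
  forall e, 0 < e -> exists2 T', T <= T' & forall t, T' <= t -> E t <= e * t ^+ 2.
Proof.
move=> T0 C0 g0 DJ JB DE e e0.
(* Half of [e] pays for the growth of [J] after [T1], half for the initial value [E T1]; the 1 added
   to [C] covers [C = 0]. *)
pose s := e / (2 * (C + 1)).
have s0 : 0 < s by rewrite divr_gt0 // mulr_gt0 // ltr_wpDl.
have sC : C * s <= e / 2.
  rewrite /s mulrA ler_pdivrMr ?mulr_gt0 ?ltr_wpDl //; nra.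
pose L := [set J t | t in [set t | T <= t]].
have supL : has_sup L by split; [exists (J T), T => /=|exists B => _ [t /= /JB tB <-]].
have [_ [T1 /= TT1 <-] JT1] := sup_adherent s0 supL.
have JE t : T <= t -> J t - J T1 <= s.
  move=> Tt; have := ub_le_sup supL.2 (imageP J Tt); lra.
pose K := `|E T1| + 1.
have K0 : 0 < K by rewrite ltr_wpDl.
exists (Num.max T1 (Num.max 1 (2 * K / e))); first by rewrite le_max TT1.
move=> t; rewrite !ge_max => /and3P[T1t t1 tK].
(* The final time [t] is frozen: for [r <= t] the factor [r ^+ 2] is at most [t ^+ 2], so this
   difference is nonincreasing in [r]. *)
have main : E t - C * t ^+ 2 * J t <= E T1 - C * t ^+ 2 * J T1.
  apply: (@le_of_derive_le0 _ (fun r => E r - C * t ^+ 2 * J r)) => // r /andP[T1r rt].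
  have Tr := le_trans TT1 T1r; have [dE [DEr dEr]] := DE r Tr.
  have := is_derive_add _ _ _ _ _ DEr (is_derive_mul _ _ _ _ _
    (is_derive_cst (- (C * t ^+ 2)) r (1 : R)) (DJ r Tr)) => D.
  exists (dE - C * t ^+ 2 * g r); split.
    rewrite (_ : (fun r => _) = fun s => E s + - (C * t ^+ 2) * J s); last first.
      by apply/funext => q; rewrite mulNr.
    by apply: (is_derive_eq D); rewrite /= mul0r add0r mulNr.
  have r0 : 0 < r by exact: lt_le_trans Tr.
  have r2 : r ^+ 2 <= t ^+ 2 by rewrite lerXn2r // nnegrE ltW // (lt_le_trans r0).
  have := ler_wpM2l C0 (ler_wpM2r (g0 r Tr) r2); lra.
have t2 : 1 <= t ^+ 2 by rewrite exprn_ege1.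
have Kt : K <= e / 2 * t ^+ 2.
  have t2t : t <= t ^+ 2 by rewrite expr2 ler_peMl // (le_trans ler01).
  rewrite ler_pdivrMr // in tK; nra.
have ET : E T1 <= K by rewrite /K (le_trans (ler_norm _)) // lerDl.
have := ler_wpM2l (mulr_ge0 C0 (sqr_ge0 t)) (JE t (le_trans TT1 T1t)).
have := ler_wpM2r (sqr_ge0 t) sC; lra.
Qed.

(** * Cancellations in the energy *)

Section PrimalDual.
Context {R : realType} {X Y : completeNormedModType R}.
Variables (ipX : {dot X for idfun}) (ipY : {dot Y for idfun}).
Variable (A : {linear X -> Y}).

(* [H] stands for the gradient of the augmented Lagrangian at the extrapolated
   point [y = x + be *: dx], [dy] for the derivative of [y], and [dbe] for the
   derivative of [be]. *)
Lemma primal_energy_rate (al t xi be dbe eps : R) (x xs dx ddx H : X) :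
  al != 0 -> t != 0 ->
  let kap := 2 * al / 3 in
  let v := kap *: (x - xs) + t *: dx in
  let dv := kap *: dx + (dx + t *: ddx) in
  let y := x + be *: dx in
  let dy := dx + (dbe *: dx + be *: ddx) in
  ddx = - (al / t) *: dx - xi *: (H + eps *: x) ->
  ipX v dv + kap * (al / 3 - 1) * ipX (x - xs) dx + t ^+ 2 * xi * ipX H dy
    + t ^+ 2 * xi * eps * ipX x dx =
  - (al / 3 - 1) * t * ipX dx dx - kap * t * xi * ipX H (y - xs)
    - t * xi * (al * be / 3 - t * dbe) * ipX dx H
    - t ^+ 2 * xi ^+ 2 * be * ipX (H + eps *: x) H
    - kap * t * xi * eps * ipX (x - xs) x.
Proof.
move=> al0 t0 /= ->; rewrite !(ipE ipX).
rewrite ?(ipC ipX dx x) ?(ipC ipX xs x) ?(ipC ipX dx xs).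
rewrite ?(ipC ipX H x) ?(ipC ipX H xs) ?(ipC ipX H dx).
by field; rewrite t0.
Qed.

(** Here [a = 1 / kap]. Substituting [ddx] in [a t be ddx] reproduces the coefficients of [A dx] and
    [A G], so the bracket in [ddl] is [A (y + a t dy) - b]. The damping contributes
    [kap + 1 - al = - (al / 3 - 1)] times [dl], whose pairing with [l - ls] cancels the second term
    on the left. *)
Lemma dual_energy_rate (al t xi be dbe : R) (x dx ddx G : X) (b l ls dl ddl : Y) :
  al != 0 -> t != 0 ->
  let kap := 2 * al / 3 in
  let w := kap *: (l - ls) + t *: dl in
  let dw := kap *: dl + (dl + t *: ddl) in
  let y := x + be *: dx in
  let dy := dx + (dbe *: dx + be *: ddx) in
  let a := 3 / (2 * al) in
  ddx = - (al / t) *: dx - xi *: G ->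
  ddl = - (al / t) *: dl + xi *: (A (x + (a * t) *: dx) - b
      + ((2 * al)^-1 * (- al * be + 3 * t * dbe)) *: A dx
      - (a * t * xi * be) *: A G) ->
  ipY w dw + kap * (al / 3 - 1) * ipY (l - ls) dl =
  - (al / 3 - 1) * t * ipY dl dl + t * xi * ipY w (A y - b)
  + t ^+ 2 * xi / kap * ipY w (A dy).
Proof.
move=> al0 t0 /= -> ->.
have AD u v : A (u + v) = A u + A v := linearD A u v.
have AZ c u : A (c *: u) = c *: A u := linearZ_LR A c u.
have AN u : A (- u) = - A u := linearN A u.
rewrite !(AD, AZ, AN) !(ipE ipY) ?(ipC ipY dl l)
  ?(ipC ipY ls l) ?(ipC ipY dl ls).
by field; rewrite t0.
Qed.

(* The cross terms are absorbed by completing two squares. *)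
Lemma cross_terms_le (HX : hilbert_ip ipX) (k c t xi be eps M : R) (x dx H : X) :
  0 < t -> 0 < k -> 0 <= be -> 1 < M ->
  c ^+ 2 <= 4 * k * (t * be) * (1 - M^-1) ->
  - k * t * ipX dx dx - t * xi * c * ipX dx H
    - t ^+ 2 * xi ^+ 2 * be * ipX (H + eps *: x) H <=
  M / 4 * be * t ^+ 2 * xi ^+ 2 * eps ^+ 2 * ipX x x.
Proof.
move=> t0 k0 be0 M1 hc.
have M0 : 0 < M by apply: lt_trans M1.
(* The term [be t^2 xi^2 |H|^2] is divided: a share [1 / M] completes the square with [eps x], and
   by the bound on [c ^+ 2] the share [1 - 1 / M] suffices for the square with [dx]. The right side
   minus the left is exactly the sum of [r1], [r2] and [r3]. *)
have s1 := ip_ge0 ipX HX (dx + (xi * c / (2 * k)) *: H).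
have s2 := ip_ge0 ipX HX (eps *: x + (2 / M) *: H).
have hH := ip_ge0 ipX HX H.
move: s1 s2; rewrite !(ipE ipX) (ipC ipX H dx) (ipC ipX H x) => s1 s2.
have r1 : 0 <= k * t * (ipX dx dx + xi * c / k * ipX dx H
     + xi ^+ 2 * c ^+ 2 / (4 * k ^+ 2) * ipX H H).
  rewrite mulr_ge0 ?mulr_ge0 ?(ltW k0) ?(ltW t0) //.
  apply: le_trans s1 _; rewrite le_eqVlt; apply/orP; left; apply/eqP; field.
  by rewrite gt_eqF.
have r2 : 0 <= M / 4 * be * t ^+ 2 * xi ^+ 2 * (eps ^+ 2 * ipX x x
     + 4 * eps / M * ipX x H + 4 / M ^+ 2 * ipX H H).
  have q : 0 <= M / 4 * be by rewrite mulr_ge0 // divr_ge0 // ltW.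
  apply: mulr_ge0; first exact: mulr_ge0 (mulr_ge0 q (sqr_ge0 _)) (sqr_ge0 _).
  apply: le_trans s2 _; rewrite le_eqVlt; apply/orP; left; apply/eqP. field.
  by rewrite gt_eqF.
have r3 : 0 <= (t * xi ^+ 2 * ipX H H) / (4 * k) *
    (4 * k * (t * be) * (1 - M^-1) - c ^+ 2).
  apply: mulr_ge0; last by rewrite subr_ge0.
  have q := mulr_ge0 (mulr_ge0 (ltW t0) (sqr_ge0 xi)) hH.
  by rewrite divr_ge0 // mulr_ge0 // ltW.
rewrite -subr_ge0; apply: le_trans (addr_ge0 (addr_ge0 r1 r2) r3) _.
rewrite le_eqVlt; apply/orP; left; apply/eqP; field.
by rewrite !gt_eqF.
Qed.

End PrimalDual.

(** * The augmented Lagrangian gap *)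

Section LagrangianGap.
Context {R : realType} {X Y : completeNormedModType R}.
Variables (ipX : {dot X for idfun}) (ipY : {dot Y for idfun}).
Hypotheses (HX : hilbert_ip ipX) (HY : hilbert_ip ipY).
Variables (f : X -> R) (gradf : X -> X).
Hypotheses (fconvex : convex_function [set: X] f) (fgrad : is_gradient ipX f gradf).
Variables (A : {linear X -> Y}) (b : Y).
Hypothesis A_cont : continuous A.

Lemma ip_eq0 (y : Y) : ipY y y = 0 -> y = 0.
Proof. by rewrite -HY => /eqP; rewrite expf_eq0 /= normr_eq0 => /eqP. Qed.

(** The saddle point may have another primal component [p]. Testing with the multiplier
    [ls + (A p - b)] forces [A p = b], whence [f xs <= f p], and [ls] serves for [xs] too. *)
Lemma saddle_multiplier (xs : X) : saddle_points ipY f A b !=set0 ->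
  solution_set f A b xs -> exists ls, forall z, f xs <= f z + ipY ls (A z - b).
Proof.
move=> [[p ls] /= sad] [Axs fxs]; exists ls => z.
have Ap : A p = b.
  have [+ _] := sad 0 (ls + (A p - b)); rewrite /lagrangian /= (ipDl ipY) => h.
  apply/eqP; rewrite -subr_eq0; apply/eqP/ip_eq0/eqP.
  by rewrite eq_le ip_ge0 // andbT; lra.
have [_] := sad z ls; rewrite /lagrangian /= Ap subrr (linear0r ipY) addr0.
exact/le_trans/fxs.
Qed.

Variables (rho : R) (ls : Y) (xs : X).
Hypotheses (rho_gt0 : 0 < rho) (xs_sol : solution_set f A b xs).
Hypothesis ls_mult : forall z, f xs <= f z + ipY ls (A z - b).

Definition gap (z : X) : R :=
  f z + ipY ls (A z - b) + rho / 2 * ipY (A z - b) (A z - b) - f xs.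

(** The differential of [gap] at [z] along [h], written with [A h] so that no adjoint enters. *)
Definition dgap (z h : X) : R :=
  ipX (gradf z) h + ipY ls (A h) + rho * ipY (A z - b) (A h).

Lemma gap_ge_residual (z : X) : rho / 2 * ipY (A z - b) (A z - b) <= gap z.
Proof. by have := ls_mult z; rewrite /gap; lra. Qed.

Lemma gap_ge0 (z : X) : 0 <= gap z.
Proof.
apply: le_trans (gap_ge_residual z); apply: mulr_ge0; last exact: ip_ge0.
by rewrite divr_ge0 // ltW.
Qed.

Lemma gap_solution : gap xs <= 0.
Proof.
rewrite /gap xs_sol.1 subrr !(linear0r ipY) mulr0 !addr0.
by rewrite subrr.
Qed.

(** The penalty term bounds the residual by the gap, so [A z = b]; the gap then reduces to
    [f z - f xs]. *)
Lemma gap_le0_solution (z : X) : gap z <= 0 -> solution_set f A b z.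
Proof.
move=> gz; have Az : A z = b.
  have := le_trans (gap_ge_residual z) gz.
  rewrite pmulr_rle0 ?divr_gt0 // => h.
  apply/eqP; rewrite -subr_eq0; apply/eqP/ip_eq0/eqP.
  by rewrite eq_le h ip_ge0.
split=> // y /xs_sol.2; apply: le_trans; move: gz.
by rewrite /gap Az subrr !(linear0r ipY) mulr0 !addr0 subr_le0.
Qed.

Lemma gap_continuous : continuous gap.
Proof.
move=> z; have rc : A s - b @[s --> z] --> A z - b.
  by apply: cvgB; [exact: A_cont|exact: cvg_cst].
apply: cvgB; last exact: cvg_cst.
apply: cvgD; last by apply: cvgMr; exact: cvg_ip.
apply: cvgD; last by apply: cvg_ip => //; exact: cvg_cst.
by have [/differentiable_continuous] := fgrad z.
Qed.

Lemma gap_midpoint (a c : X) (r : R) : gap a <= r -> gap c <= r ->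
  gap (2^-1 *: (a + c)) <= r.
Proof.
have h0 : 0 <= (2^-1 : R) by [].
have h1 : (2^-1 : R) <= 1 by lra.
have : f (2^-1 *: a + (1 - 2^-1) *: c) <= 2^-1 * f a + (1 - 2^-1) * f c :=
  fconvex (Itv01 h0 h1) a c (mem_set I) (mem_set I).
have -> : (1 - 2^-1 : R) = 2^-1 by field.
rewrite -scalerDr => fm.
have Am : A (2^-1 *: (a + c)) - b = 2^-1 *: ((A a - b) + (A c - b)).
  rewrite linearZ_LR linearD addrACA -opprD scalerBr; congr (_ - _).
  by rewrite -mulr2n -(scaler_nat 2 b) scalerA mulVf ?scale1r.
have := ip_ge0 ipY HY ((A a - b) - (A c - b)).
rewrite /gap Am; move: (A a - b) (A c - b) => u v.
rewrite !(ipE ipY) (ipC ipY v u) => uv ga gc.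
have := ltW rho_gt0 => r0; nra.
Qed.

(** The tangent inequality handles [f], the multiplier term is affine, and differentiating the
    penalty doubles it, leaving a nonnegative excess. *)
Lemma gap_le_dgap (z : X) : gap z <= dgap z (z - xs).
Proof.
have := convex_gradient_le ipX f gradf fgrad z xs fconvex.
rewrite -opprB (ipNr ipX) => fz.
have Ar : A (z - xs) = A z - b by rewrite linearB xs_sol.1.
have := ip_ge0 ipY HY (A z - b); rewrite /gap /dgap Ar => r0; have := ltW rho_gt0; nra.
Qed.

Lemma is_derive_gap (u : R -> X) (t : R) (du : X) :
  is_derive t 1 u du -> is_derive t 1 (gap \o u) (dgap (u t) du).
Proof.
move=> Du; have Df := is_derive_gradient ipX f gradf fgrad u t du Du.
have Dr := is_derive_subc _ _ _ b (is_derive_continuous_linear _ _ _ A u t du A_cont Du).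
have Dl := is_derive_ip ipY HY _ _ _ _ _ (is_derive_cst ls t 1) Dr.
have Dq := is_derive_ip ipY HY _ _ _ _ _ Dr Dr.
have Dc := is_derive_cst (rho / 2) t (1 : R).
have := is_derive_subc _ _ _ (f xs) (is_derive_add _ _ _ _ _
  (is_derive_add _ _ _ _ _ Df Dl) (is_derive_mul _ _ _ _ _ Dc Dq)).
move=> /is_derive_eq; apply; rewrite /dgap /= (linear0l ipY) (ipC ipY (A du)).
by field.
Qed.

Lemma gap_tikhonov (xs_min : forall y, solution_set f A b y -> `|xs| <= `|y|) :
  forall e, 0 < e -> exists2 tau, 0 < tau &
    forall y, gap y <= tau -> `|y| <= `|xs| + tau -> `|y - xs| < e.
Proof.
apply: (min_norm_stable ipX HX); first exact: gap_continuous.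
- exact: gap_midpoint.
- exact: gap_solution.
- by move=> y /gap_le0_solution /xs_min.
Qed.

End LagrangianGap.

(** * Energy estimates along a trajectory *)

Section Energy.
Context {R : realType} {X Y : completeNormedModType R}.
Variables (ipX : {dot X for idfun}) (ipY : {dot Y for idfun}).
Hypotheses (HX : hilbert_ip ipX) (HY : hilbert_ip ipY).
Variables (f : X -> R) (gradf : X -> X).
Hypotheses (fconvex : convex_function [set: X] f) (fgrad : is_gradient ipX f gradf).
Variables (A : {linear X -> Y}) (AT : Y -> X) (b : Y).
Hypotheses (A_cont : continuous A) (AT_adj : is_adjoint ipX ipY A AT).
Variables (rho : R) (ls : Y) (xs : X).
Hypotheses (rho_gt0 : 0 < rho) (xs_sol : solution_set f A b xs).
Hypothesis ls_mult : forall z, f xs <= f z + ipY ls (A z - b).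
Variables (t0 alpha gamma beta : R).
Hypotheses (t0_gt0 : 0 < t0) (alpha_gt3 : 3 < alpha).
Variables (xi dxi eps deps : R -> R) (x dx ddx : R -> X) (l dl ddl : R -> Y).
Hypothesis xi_gt0 : forall t, t0 < t -> 0 < xi t.
Hypothesis eps_ge0 : forall t, t0 < t -> 0 <= eps t.
Hypothesis xi_derive : forall t, t0 < t -> is_derive t 1 xi (dxi t).
Hypothesis eps_derive : forall t, t0 < t -> is_derive t 1 eps (deps t).
Hypothesis x_derive : forall t, t0 < t -> is_derive t 1 x (dx t).
Hypothesis dx_derive : forall t, t0 < t -> is_derive t 1 dx (ddx t).
Hypothesis l_derive : forall t, t0 < t -> is_derive t 1 l (dl t).
Hypothesis dl_derive : forall t, t0 < t -> is_derive t 1 dl (ddl t).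

(* Unqualified, [beta_fun] is the Euler Beta function of [all_analysis]. *)
Local Notation be := (Defs.beta_fun gamma beta).
Local Notation kap := (2 * alpha / 3).
Local Notation k2 := (kap * (alpha / 3 - 1)).
Local Notation gap := (gap ipY f A b rho ls xs).
Local Notation dgap := (dgap ipX ipY gradf A b rho ls).

Definition xhat t : X := x t + be t *: dx t.
Definition gradL t : X :=
  grad_x_Lrho gradf A AT b rho (xhat t) (l t + (3 / (2 * alpha) * t) *: dl t).

Hypothesis ode_primal : forall t, t0 < t ->
  ddx t + (alpha / t) *: dx t + xi t *: (gradL t + eps t *: x t) = 0.
Hypothesis ode_dual : forall t, t0 < t ->
  ddl t + (alpha / t) *: dl t
    - xi t *: (grad_l_Lrho A b (x t + (3 / (2 * alpha) * t) *: dx t) (l t)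
               + eta_fun alpha gamma beta t *: A (dx t)
               - (3 / (2 * alpha) * t * xi t * be t) *: A (gradL t + eps t *: x t)) = 0.

Let dbe (t : R) := - beta / t ^+ 2.
Let v t : X := kap *: (x t - xs) + t *: dx t.
Let w t : Y := kap *: (l t - ls) + t *: dl t.
Let S t := t ^+ 2 * xi t * eps t.
Let dS t := (2 * t * xi t + t ^+ 2 * dxi t) * eps t + t ^+ 2 * xi t * deps t.

(** The weight [k2] is chosen so that the pairings of [x - xs] with [dx] and of [l - ls] with [dl]
    cancel in the derivative. *)
Definition energy t : R :=
  t ^+ 2 * xi t * gap (xhat t) + S t / 2 * ipX (x t) (x t)
  + 2^-1 * ipX (v t) (v t) + k2 / 2 * ipX (x t - xs) (x t - xs)
  + (2^-1 * ipY (w t) (w t) + k2 / 2 * ipY (l t - ls) (l t - ls)).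

Lemma beta_fun_derive (t : R) : 0 < t -> is_derive t 1 be (dbe t).
Proof.
move=> tp; have tn : id t != 0 by rewrite /= gt_eqF.
have Dc := is_derive_mul _ _ _ _ _ (is_derive_cst beta t (1 : R))
  (is_deriveV tn (is_derive_id t (1 : R))).
have := is_derive_add _ _ _ _ _ (is_derive_cst gamma t (1 : R)) Dc.
move=> /is_derive_eq; apply; rewrite /dbe /= /GRing.scale /=.
by field; rewrite gt_eqF.
Qed.

Lemma energy_derive t : t0 < t ->
  is_derive t 1 energy
    ((2 * t * xi t + t ^+ 2 * dxi t) * gap (xhat t)
     + t ^+ 2 * xi t * dgap (xhat t) (dx t + (dbe t *: dx t + be t *: ddx t))
     + (dS t / 2 * ipX (x t) (x t) + S t * ipX (x t) (dx t))
     + (ipX (v t) (kap *: dx t + (dx t + t *: ddx t)) + k2 * ipX (x t - xs) (dx t))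
     + (ipY (w t) (kap *: dl t + (dl t + t *: ddl t)) + k2 * ipY (l t - ls) (dl t))).
Proof.
move=> t0t; have t_gt0 : 0 < t by exact: lt_trans t0t.
have dcst (c : R) := is_derive_cst c t (1 : R).
have did := is_derive_id t (1 : R).
have dt2 := is_derive_mul _ _ _ _ _ did did.
have dt2xi := is_derive_mul _ _ _ _ _ dt2 (xi_derive t t0t).
have dSt := is_derive_mul _ _ _ _ _ dt2xi (eps_derive t t0t).
have Dx := x_derive t t0t; have Dl := l_derive t t0t.
have Dxh := is_derive_add _ _ _ _ _ Dx
  (is_derive_scale _ _ _ _ _ (beta_fun_derive t t_gt0) (dx_derive t t0t)).
have Dgap := is_derive_gap ipX ipY HY f gradf fgrad A b A_cont rho ls xs _ _ _ Dxh.
have Dxx := is_derive_ip ipX HX _ _ _ _ _ Dx Dx.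
have Dxs := is_derive_subc _ _ _ xs Dx; have Dls := is_derive_subc _ _ _ ls Dl.
have Dv := is_derive_add _ _ _ _ _ (is_derive_scale _ _ _ _ _ (dcst kap) Dxs)
  (is_derive_scale _ _ _ _ _ did (dx_derive t t0t)).
have Dw := is_derive_add _ _ _ _ _ (is_derive_scale _ _ _ _ _ (dcst kap) Dls)
  (is_derive_scale _ _ _ _ _ did (dl_derive t t0t)).
have Dvv := is_derive_ip ipX HX _ _ _ _ _ Dv Dv.
have Dww := is_derive_ip ipY HY _ _ _ _ _ Dw Dw.
have Dxxs := is_derive_ip ipX HX _ _ _ _ _ Dxs Dxs.
have Dlls := is_derive_ip ipY HY _ _ _ _ _ Dls Dls.
have D1 := is_derive_mul _ _ _ _ _ dt2xi Dgap.
have D2 := is_derive_mul _ _ _ _ _ (is_derive_mul _ _ _ _ _ dSt (dcst 2^-1)) Dxx.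
have D3 := is_derive_mul _ _ _ _ _ (dcst 2^-1) Dvv.
have D4 := is_derive_mul _ _ _ _ _ (dcst (k2 / 2)) Dxxs.
have D5 := is_derive_mul _ _ _ _ _ (dcst 2^-1) Dww.
have D6 := is_derive_mul _ _ _ _ _ (dcst (k2 / 2)) Dlls.
have D := is_derive_add _ _ _ _ _ (is_derive_add _ _ _ _ _ (is_derive_add _ _ _ _ _
  (is_derive_add _ _ _ _ _ D1 D2) D3) D4) (is_derive_add _ _ _ _ _ D5 D6).
apply: (is_derive_eq D); rewrite /= !scale0r !add0r !scale1r.
rewrite (ipC ipX (dx t) (x t)) (ipC ipX (dx t) (x t - xs)) (ipC ipY (dl t) (l t - ls)).
rewrite -/(v t) -/(w t) (ipC ipX (_ *: dx t + _) (v t)) (ipC ipY (_ *: dl t + _) (w t)).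
rewrite /dS /S; set q1 := gap _; set q2 := dgap _ _; set q3 := ipX (v t) (_ *: dx t + _).
set q4 := ipY (w t) (_ *: dl t + _).
by field.
Qed.

(** The gradient is taken at the extrapolated multiplier, which differs from [ls] by exactly
    [w t / kap]. This is the source of the primal-dual coupling. *)
Lemma dgap_gradL t (h : X) : 0 < t ->
  dgap (xhat t) h = ipX (gradL t) h - ipY (w t) (A h) / kap.
Proof.
move=> t_gt0.
rewrite /gradL /grad_x_Lrho !(ipE ipX) !(ipC ipX _ h) -!AT_adj /w /dgap.
rewrite !(ipC ipY _ (A h)) !(ipE ipY) (ipC ipX _ h).
by field; rewrite gt_eqF // (lt_trans _ alpha_gt3).
Qed.

(** The coupling along the velocity of [xhat] cancels between the two rates at once; the one along
    [xhat - xs] cancels after [gap_le_dgap]. The growth condition on [xi] makes the coefficient of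
    the gap nonpositive, and [cross_terms_le] leaves only Tikhonov terms. *)
Lemma energy_rate t M : t0 < t -> 1 < M -> 0 <= be t ->
  (alpha * be t / 3 - t * dbe t) ^+ 2
    <= 4 * (alpha / 3 - 1) * (t * be t) * (1 - M^-1) ->
  2 * t * xi t + t ^+ 2 * dxi t <= kap * t * xi t ->
  exists dE, is_derive t 1 energy dE /\
    dE <= dS t / 2 * ipX (x t) (x t) - kap * t * xi t * eps t * ipX (x t - xs) (x t)
          + M / 4 * be t * t ^+ 2 * xi t ^+ 2 * eps t ^+ 2 * ipX (x t) (x t).
Proof.
move=> t0t M1 be0 hc hxi; have t_gt0 : 0 < t by exact: lt_trans t0t.
have al0 : alpha != 0 by rewrite gt_eqF // (lt_trans _ alpha_gt3).
have tn0 : t != 0 by rewrite gt_eqF.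
have k0 : 0 < alpha / 3 - 1 by have := alpha_gt3; lra.
have ddxE : ddx t = - (alpha / t) *: dx t - xi t *: (gradL t + eps t *: x t).
  have /eqP := ode_primal t t0t.
  by rewrite -addrA addr_eq0 opprD scaleNr => /eqP.
have ddlE : ddl t = - (alpha / t) *: dl t + xi t *:
    (A (x t + (3 / (2 * alpha) * t) *: dx t) - b
      + ((2 * alpha)^-1 * (- alpha * be t + 3 * t * dbe t)) *: A (dx t)
      - (3 / (2 * alpha) * t * xi t * be t) *: A (gradL t + eps t *: x t)).
  have /eqP := ode_dual t t0t; rewrite subr_eq0 /grad_l_Lrho /eta_fun.
  have [_] := beta_fun_derive t t_gt0; rewrite -derive1E => ->.
  by move=> /eqP E; rewrite -[LHS](addrK ((alpha / t) *: dl t)) E addrC scaleNr.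
eexists; split; first exact: energy_derive.
have P := primal_energy_rate ipX alpha t (xi t) (be t) (dbe t) (eps t) (x t) xs
  (dx t) (ddx t) (gradL t) al0 tn0 ddxE.
have Q := dual_energy_rate ipY A alpha t (xi t) (be t) (dbe t) (x t) (dx t) (ddx t)
  _ b (l t) ls (dl t) (ddl t) al0 tn0 ddxE ddlE.
have C := cross_terms_le ipX HX _ _ t (xi t) (be t) (eps t) M (x t) (dx t) (gradL t)
  t_gt0 k0 be0 M1 hc.
rewrite /= -/(v t) -/(w t) -/(xhat t) in P Q.
have G := gap_le_dgap ipX ipY HY f gradf fconvex fgrad A b rho ls xs rho_gt0
  xs_sol (xhat t).
have G0 := gap_ge0 ipY HY f A b rho ls xs rho_gt0 ls_mult (xhat t).
have dl0 := ip_ge0 ipY HY (dl t).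
rewrite (dgap_gradL t _ t_gt0); rewrite (dgap_gradL t _ t_gt0) in G.
have Ar : A (xhat t - xs) = A (xhat t) - b by rewrite linearB xs_sol.1.
rewrite Ar in G.
have xi0 := xi_gt0 t t0t.
have ktx : 0 <= kap * t * xi t.
  by have := alpha_gt3 => a3; rewrite !mulr_ge0 // ?ltW //; lra.
have G1 := ler_wpM2l ktx G; have G2 := ler_wpM2r G0 hxi.
have G3 := mulr_ge0 (mulr_ge0 (ltW k0) (ltW t_gt0)) dl0.
have {}G1 : kap * t * xi t * gap (xhat t) <= kap * t * xi t * ipX (gradL t) (xhat t - xs)
    - t * xi t * ipY (w t) (A (xhat t) - b).
  apply: le_trans G1 _; rewrite le_eqVlt; apply/orP; left; apply/eqP.
  by field.
rewrite (mulrBr (t ^+ 2 * xi t)) [_ * (_ / kap)]mulrCA [ipY _ _ * _]mulrC.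
rewrite /S; move: P Q C G1 G2 G3.
(* With the products named, the claim is a linear combination of [P], [Q], [C], [G1], [G2] and
   [G3]. *)
set p1 := ipX (v t) _; set p2 := k2 * ipX _ _; set p3 := t ^+ 2 * xi t * ipX _ _.
set p4 := _ * eps t * ipX (x t) (dx t).
set p5 := - (alpha / 3 - 1) * t * ipX _ _; set p6 := kap * t * xi t * ipX _ _.
set p7 := _ * ipX (dx t) (gradL t); set p8 := _ * ipX (_ + _) _.
set p9 := _ * ipX (_ - _) _; set p10 := _ * ipX (x t) (x t).
set q1 := ipY (w t) (_ *: dl t + _); set q2 := k2 * ipY _ _; set q3 := t * xi t * ipY _ _.
set q4 := _ * ipY (w t) (A _).
set g1 := _ * gap _; set g2 := _ * gap _.
rewrite !mulNr; set d := _ * ipY _ _; set n := dS t / 2 * _.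
clearbody p1 p2 p3 p4 p5 p6 p7 p8 p9 p10 q1 q2 q3 q4 g1 g2 d n.
by move=> *; lra.
Qed.

Lemma kap_gt0 : 0 < kap.
Proof. by have := alpha_gt3; lra. Qed.

Lemma k2_gt0 : 0 < k2.
Proof. by apply: mulr_gt0; have := alpha_gt3; lra. Qed.

Lemma energy_lower t : t0 < t ->
  t ^+ 2 * xi t * gap (xhat t) + S t / 2 * ipX (x t) (x t)
  + 2^-1 * ipX (v t) (v t) + k2 / 2 * ipX (x t - xs) (x t - xs) <= energy t.
Proof.
move=> _; rewrite /energy lerDl addr_ge0 // mulr_ge0 ?ip_ge0 //.
by rewrite divr_ge0 // ltW // k2_gt0.
Qed.

Lemma S_ge0 t : t0 < t -> 0 <= S t.
Proof.
move=> t0t.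
exact: mulr_ge0 (mulr_ge0 (sqr_ge0 t) (ltW (xi_gt0 t t0t))) (eps_ge0 t t0t).
Qed.

Lemma S_derive t : t0 < t -> is_derive t 1 S (dS t).
Proof.
move=> t0t; have did := is_derive_id t (1 : R).
have D := is_derive_mul _ _ _ _ _ (is_derive_mul _ _ _ _ _
  (is_derive_mul _ _ _ _ _ did did) (xi_derive t t0t)) (eps_derive t t0t).
by apply: (is_derive_eq D); rewrite /dS /=; ring.
Qed.

(** * Energy rates for large times *)

Variables (M T1 Bbe c : R).
Hypotheses (M_gt1 : 1 < M) (t0_lt_T1 : t0 < T1).
Hypothesis be_ge0 : forall t, T1 <= t -> 0 <= be t.
Hypothesis be_le : forall t, T1 <= t -> be t <= Bbe.
Hypothesis be_large : forall t, T1 <= t ->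
  (alpha * be t / 3 - t * dbe t) ^+ 2
    <= 4 * (alpha / 3 - 1) * (t * be t) * (1 - M^-1).
Hypothesis xi_growth : forall t, T1 <= t ->
  2 * t * xi t + t ^+ 2 * dxi t <= kap * t * xi t.
Hypothesis eps_decay : forall t, T1 <= t ->
  2 * deps t + M * be t * xi t * eps t ^+ 2 <= 0.
Hypothesis c_gt0 : 0 < c.
Hypothesis c_le_xi : forall t, T1 <= t -> c <= xi t.
Hypothesis xs_min : forall y, solution_set f A b y -> `|xs| <= `|y|.

(** The negative term is what [eps_decay] yields, and it matches the squared-[eps] term left by
    [cross_terms_le]. The factor [q] will be [|x|^2], and outside the ball [|x|^2 - |xs|^2]. *)
Lemma eps_decay_scaled t (q : R) : T1 <= t -> 0 <= q ->
  dS t / 2 * q <= kap * t * xi t * eps t / 2 * q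
                  - M / 4 * be t * t ^+ 2 * xi t ^+ 2 * eps t ^+ 2 * q.
Proof.
move=> T1t q0; have t0t := lt_le_trans t0_lt_T1 T1t.
have xi0 := ltW (xi_gt0 t t0t).
have h1 := ler_wpM2r q0 (ler_wpM2r (eps_ge0 t t0t) (xi_growth t T1t)).
have h2 := mulr_ge0_le0 (mulr_ge0 (mulr_ge0 (sqr_ge0 t) xi0) q0) (eps_decay t T1t).
have -> : kap * t * xi t * eps t / 2 * q
    - M / 4 * be t * t ^+ 2 * xi t ^+ 2 * eps t ^+ 2 * q
  = dS t / 2 * q + (kap * t * xi t * eps t * q
      - (2 * t * xi t + t ^+ 2 * dxi t) * eps t * q) / 2
    - t ^+ 2 * xi t * q * (2 * deps t + M * be t * xi t * eps t ^+ 2) / 4.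
  by rewrite /dS; field.
lra.
Qed.

Lemma ip_sub_xs t : ipX (x t - xs) (x t)
  = (ipX (x t - xs) (x t - xs) + ipX (x t) (x t) - ipX xs xs) / 2.
Proof. by rewrite !(ipE ipX) (ipC ipX xs (x t)); field. Qed.

(** Taking [q = |x|^2] and expanding by [ip_sub_xs], all terms in [|x|^2] cancel and only [|xs|^2]
    is left as a source. The factor [t ^+ 2] is displayed for [kronecker_bound]. *)
Lemma energy_rate_tikhonov t : T1 <= t ->
  exists dE, is_derive t 1 energy dE /\
    dE <= kap / 2 * ipX xs xs * (t ^+ 2 * (xi t * eps t / t)).
Proof.
move=> T1t; have t0t := lt_le_trans t0_lt_T1 T1t.
have t_gt0 : 0 < t by exact: lt_trans t0t.
have [dE [DE dEle]] := energy_rate t M t0t M_gt1 (be_ge0 t T1t) (be_large t T1t)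
  (xi_growth t T1t).
exists dE; split => //; apply: le_trans dEle _.
have := eps_decay_scaled t _ T1t (ip_ge0 ipX HX (x t)).
have k0 : 0 <= kap * t * xi t * eps t.
  exact: mulr_ge0 (mulr_ge0 (mulr_ge0 (ltW kap_gt0) (ltW t_gt0))
    (ltW (xi_gt0 t t0t))) (eps_ge0 t t0t).
have := mulr_ge0 k0 (ip_ge0 ipX HX (x t - xs)).
have -> : kap / 2 * ipX xs xs * (t ^+ 2 * (xi t * eps t / t))
  = kap * t * xi t * eps t * ipX xs xs / 2 by field; rewrite gt_eqF.
rewrite ip_sub_xs; set u := ipX (_ - _) _; set q := ipX (x t) _; set r := ipX xs xs.
by lra.
Qed.

(* Outside the ball of radius [|xs|] the Tikhonov term of the energy may be
   measured from [|xs|]^2, and only a term in [eps]^2 remains. *)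
Lemma energy_rate_outside t : T1 <= t -> ipX xs xs <= ipX (x t) (x t) ->
  exists dE, is_derive t 1 (fun s => energy s - ipX xs xs / 2 * S s) dE /\
    dE <= M / 4 * Bbe * ipX xs xs * (t ^+ 2 * xi t ^+ 2 * eps t ^+ 2).
Proof.
move=> T1t out; have t0t := lt_le_trans t0_lt_T1 T1t.
have t_gt0 : 0 < t by exact: lt_trans t0t.
have [dE [DE dEle]] := energy_rate t M t0t M_gt1 (be_ge0 t T1t) (be_large t T1t)
  (xi_growth t T1t).
exists (dE - ipX xs xs / 2 * dS t); split.
  have D := is_derive_add _ _ _ _ _ DE (is_derive_mul _ _ _ _ _
    (is_derive_cst (- (ipX xs xs / 2)) t (1 : R)) (S_derive t t0t)).
  rewrite (_ : (fun s => _) = fun s => energy s + - (ipX xs xs / 2) * S s); last first.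
    by apply/funext => s; rewrite mulNr.
  by apply: (is_derive_eq D); rewrite /= mul0r add0r mulNr.
(* With this difference as [q], the squared-[eps] term is absorbed except for its [|xs|^2] part,
   which [h3] bounds. *)
have q0 : 0 <= ipX (x t) (x t) - ipX xs xs by rewrite subr_ge0.
have h := eps_decay_scaled t _ T1t q0.
have k0 : 0 <= kap * t * xi t * eps t.
  exact: mulr_ge0 (mulr_ge0 (mulr_ge0 (ltW kap_gt0) (ltW t_gt0))
    (ltW (xi_gt0 t t0t))) (eps_ge0 t t0t).
have h2 := mulr_ge0 k0 (ip_ge0 ipX HX (x t - xs)).
have M0 : 0 <= M / 4 by rewrite divr_ge0 // ltW // (lt_trans _ M_gt1).
have P0 : 0 <= t ^+ 2 * xi t ^+ 2 * eps t ^+ 2.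
  exact: mulr_ge0 (mulr_ge0 (sqr_ge0 t) (sqr_ge0 (xi t))) (sqr_ge0 (eps t)).
have h3 : M / 4 * be t * t ^+ 2 * xi t ^+ 2 * eps t ^+ 2 * ipX xs xs
    <= M / 4 * Bbe * ipX xs xs * (t ^+ 2 * xi t ^+ 2 * eps t ^+ 2).
  have := ler_wpM2l (mulr_ge0 (mulr_ge0 M0 P0) (ip_ge0 ipX HX xs)) (be_le t T1t).
  by congr (_ <= _); ring.
apply: le_trans h3; rewrite ip_sub_xs in dEle; move: dEle h h2.
set u := ipX (_ - _) _; set q := ipX (x t) _; set r := ipX xs xs.
by lra.
Qed.

(** * From the energy to the trajectory, with [J] and [I] primitives of the two source terms *)

Variables (J I : R -> R) (BJ : R).
Hypothesis J_derive : forall t, t0 < t -> is_derive t 1 J (xi t * eps t / t).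
Hypothesis J_le : forall t, t0 < t -> J t <= BJ.
Hypothesis I_derive : forall t, t0 < t ->
  is_derive t 1 I (t ^+ 2 * xi t ^+ 2 * eps t ^+ 2).

Lemma energy_littleo e : 0 < e ->
  exists2 T, T1 <= T & forall t, T <= t -> energy t <= e * t ^+ 2.
Proof.
have T1_gt t : T1 <= t -> t0 < t by exact: lt_le_trans.
apply: (kronecker_bound _ energy J (fun t => xi t * eps t / t)
  (kap / 2 * ipX xs xs) BJ T1).
- exact: lt_trans t0_lt_T1.
- by apply: mulr_ge0; [rewrite divr_ge0 // ltW // kap_gt0|exact: ip_ge0].
- move=> t /T1_gt t0t; rewrite divr_ge0 ?mulr_ge0 ?eps_ge0 ?(ltW (xi_gt0 t t0t)) //.
  by rewrite ltW // (lt_trans t0_gt0).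
- by move=> t /T1_gt; exact: J_derive.
- by move=> t /T1_gt; exact: J_le.
- exact: energy_rate_tikhonov.
Qed.

(** Dividing the energy bound by [t ^+ 2 * xi] controls the gap. The energy also bounds [v] and
    [x - xs], hence [t *: dx = v - kap *: (x - xs)], and division by [t] bounds the velocity. *)
Lemma gap_velocity_small e : 0 < e -> exists2 T, T1 <= T &
  forall t, T <= t -> gap (xhat t) <= e /\ `|be t *: dx t| <= e.
Proof.
move=> e0; have k20 := k2_gt0.
(* An energy of at most [e1 * t ^+ 2] will give [|dx|^2 <= 4 e1 (1 + kap^2 / k2)]; the remaining
   factor dominates [be ^+ 2], its 1 keeping [K] positive. *)
pose K := 4 * (Bbe ^+ 2 + 1) * (1 + kap ^+ 2 / k2).
have K0 : 0 < K.
  rewrite /K mulr_gt0 //; first by rewrite mulr_gt0 // ltr_wpDl // sqr_ge0.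
  by rewrite ltr_wpDr // divr_ge0 ?sqr_ge0 // ltW.
pose e1 := Num.min (c * e) (e ^+ 2 / K).
have e10 : 0 < e1 by rewrite lt_min mulr_gt0 // divr_gt0 // exprn_gt0.
have [T T1T TE] := energy_littleo e1 e10.
exists T => // t Tt; have T1t := le_trans T1T Tt.
have t0t := lt_le_trans t0_lt_T1 T1t.
have t_gt0 : 0 < t by exact: lt_trans t0t.
have t2 : 0 < t ^+ 2 by rewrite exprn_gt0.
have xi0 := xi_gt0 t t0t.
have g0 := gap_ge0 ipY HY f A b rho ls xs rho_gt0 ls_mult (xhat t).
have lowE := le_trans (energy_lower t t0t) (TE t Tt).
have a1 : 0 <= t ^+ 2 * xi t * gap (xhat t).
  exact: mulr_ge0 (mulr_ge0 (ltW t2) (ltW xi0)) g0.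
have a2 : 0 <= S t / 2 * ipX (x t) (x t).
  by apply: mulr_ge0; [rewrite divr_ge0 // S_ge0|exact: ip_ge0].
have a3 : 0 <= 2^-1 * ipX (v t) (v t) by rewrite mulr_ge0 ?ip_ge0.
have a4 : 0 <= k2 / 2 * ipX (x t - xs) (x t - xs).
  by rewrite mulr_ge0 ?ip_ge0 // divr_ge0 // ltW.
split.
  have gE : t ^+ 2 * (xi t * gap (xhat t)) <= t ^+ 2 * e1 by rewrite mulrA; lra.
  rewrite ler_pM2l // in gE.
  have := ler_wpM2r g0 (c_le_xi t T1t) => cg.
  by rewrite -(ler_pM2l c_gt0) (le_trans cg) // (le_trans gE) // ge_min lexx.
have vE : ipX (v t) (v t) <= 2 * e1 * t ^+ 2 by lra.
have zE : k2 * ipX (x t - xs) (x t - xs) <= 2 * e1 * t ^+ 2.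
  by lra.
(* This square yields [|v - kap z|^2 <= 2 |v|^2 + 2 kap^2 |z|^2] with [z = x - xs]. *)
have := ip_ge0 ipX HX (v t + kap *: (x t - xs)).
have dxE : t *: dx t = v t - kap *: (x t - xs) by rewrite /v addrAC subrr add0r.
have : ipX (t *: dx t) (t *: dx t) = t ^+ 2 * ipX (dx t) (dx t).
  by rewrite !(ipE ipX); ring.
rewrite dxE; move: (v t) (x t - xs) vE zE => v' z vE zE.
rewrite !(ipDl ipX, ipDr ipX, ipNl ipX, ipNr ipX, ipZl ipX, ipZr ipX) (ipC ipX z v').
move=> dxv sum0.
have zE' : kap ^+ 2 * ipX z z <= 2 * e1 * (kap ^+ 2 / k2) * t ^+ 2.
  rewrite [X in _ <= X](_ : _ = kap ^+ 2 * (2 * e1 * t ^+ 2 / k2)).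
    by rewrite ler_wpM2l ?sqr_ge0 // ler_pdivlMr // mulrC.
  by move: (k2) => k; ring.
have dxE2 : ipX (dx t) (dx t) <= 4 * e1 * (1 + kap ^+ 2 / k2).
  rewrite -(ler_pM2l t2) -dxv; move: zE' sum0; rewrite expr2.
  by move: (kap ^+ 2 / k2) => k; lra.
rewrite -(@ler_pXn2r _ 2) ?nnegrE ?(ltW e0) // HX !(ipE ipX) mulrA -expr2.
have be2 : be t ^+ 2 <= Bbe ^+ 2 + 1.
  have b0 := be_ge0 t T1t; have bB := be_le t T1t.
  have : be t ^+ 2 <= Bbe ^+ 2 by rewrite lerXn2r ?nnegrE // (le_trans b0).
  by lra.
have B1 : 0 <= Bbe ^+ 2 + 1 by rewrite addr_ge0 // sqr_ge0.
apply: le_trans (ler_wpM2r (ip_ge0 ipX HX _) be2) _.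
apply: le_trans (ler_wpM2l B1 dxE2) _.
have : e1 <= e ^+ 2 / K by rewrite ge_min lexx orbT.
rewrite ler_pdivlMr //; apply: le_trans; rewrite le_eqVlt; apply/orP; left.
by apply/eqP; rewrite /K; move: (kap ^+ 2 / k2) => k; ring.
Qed.

(** [gap_tikhonov] is applied at [xhat], where the gap is small; half of [tau] and half of [e] pay
    for the distance from [xhat] to [x]. *)
Lemma norm_le_close e : 0 < e -> exists2 tau, 0 < tau &
  exists2 T, T1 <= T &
    forall t, T <= t -> `|x t| <= `|xs| + tau -> `|x t - xs| < e.
Proof.
move=> e0; have e2 : 0 < e / 2 by rewrite divr_gt0.
have [tau tau0 tauP] := gap_tikhonov ipX ipY HX HY f gradf fconvex fgrad A b A_cont
  rho ls xs rho_gt0 xs_sol ls_mult xs_min (e / 2) e2.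
have tau2 : 0 < tau / 2 by rewrite divr_gt0.
exists (tau / 2) => //.
have m0 : 0 < Num.min (tau / 2) (e / 2) by rewrite lt_min tau2.
have [T T1T TP] := gap_velocity_small _ m0; exists T => // t Tt xt.
have [gt] := TP t Tt; rewrite le_min => /andP[vtau ve].
have gtau : gap (xhat t) <= tau.
  by apply: le_trans gt _; rewrite ge_min; apply/orP; left; lra.
have xh : `|xhat t| <= `|xs| + tau.
  by have := ler_normD (x t) (be t *: dx t); rewrite /xhat; lra.
have := tauP (xhat t) gtau xh.
have := ler_distD (xhat t) (x t) xs.
by rewrite (_ : x t - xhat t = - (be t *: dx t)) ?normrN /xhat ?opprD ?addNKr //; lra.
Qed.

(** Integrating [energy_rate_outside] bounds [S (|x|^2 - |xs|^2) / 2] by a constant plus [C * I];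
    both are negligible against [S]. *)
Lemma norm_le_of_outside :
  (forall e, 0 < e -> exists T, forall t, T <= t -> I t <= e * S t) ->
  (forall K, exists T, forall t, T <= t -> K <= S t) ->
  (exists T, forall t, T <= t -> `|xs| <= `|x t|) ->
  forall tau, 0 < tau -> exists T, forall t, T <= t -> `|x t| <= `|xs| + tau.
Proof.
move=> IS Sy [T0 out] tau tau0.
pose C := M / 4 * Bbe * ipX xs xs.
have C0 : 0 <= C.
  apply: mulr_ge0; last exact: ip_ge0.
  apply: mulr_ge0; first by rewrite divr_ge0 // ltW // (lt_trans _ M_gt1).
  exact: le_trans (be_ge0 T1 (lexx _)) (be_le T1 (lexx _)).
pose T2 := Num.max T0 T1.
have T2P t : T2 <= t -> T1 <= t /\ ipX xs xs <= ipX (x t) (x t).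
  rewrite ge_max => /andP[T0t T1t]; split => //.
  by rewrite -!HX lerXn2r ?nnegrE // out.
pose F t := energy t - ipX xs xs / 2 * S t - C * I t.
have F_le t : T2 <= t -> F t <= F T2.
  move=> T2t; apply: le_of_derive_le0 => // r /andP[T2r _].
  have [T1r outr] := T2P r T2r; have t0r := lt_le_trans t0_lt_T1 T1r.
  have [dE [DE dEle]] := energy_rate_outside r T1r outr.
  have D := is_derive_add _ _ _ _ _ DE (is_derive_mul _ _ _ _ _
    (is_derive_cst (- C) r (1 : R)) (I_derive r t0r)).
  exists (dE - C * (r ^+ 2 * xi r ^+ 2 * eps r ^+ 2)); split.
    rewrite (_ : F = fun s => energy s - ipX xs xs / 2 * S s + - C * I s); last first.
      by apply/funext => s; rewrite mulNr.
    by apply: (is_derive_eq D); rewrite /= mul0r add0r mulNr.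
  by rewrite subr_le0.
(* The constant costs [s * S] and the integral [C * s * S], so [|x|^2 <= |xs|^2 + tau^2], which is
   at most [(|xs| + tau)^2]. *)
pose s := tau ^+ 2 / (2 * (C + 1)).
have s0 : 0 < s by rewrite divr_gt0 ?exprn_gt0 // mulr_gt0 // ltr_wpDl.
have [T3 IP] := IS s s0; have [T4 SP] := Sy (Num.max 1 (F T2 / s)).
exists (Num.max T2 (Num.max T3 T4)) => t.
rewrite ge_max => /andP[T2t]; rewrite ge_max => /andP[T3t T4t].
have [T1t _] := T2P t T2t; have t0t := lt_le_trans t0_lt_T1 T1t.
have := SP t T4t; rewrite ge_max => /andP[S1 SF].
rewrite ler_pdivrMr // in SF.
have t_gt0 : 0 < t by exact: lt_trans t0t.
have lowE := energy_lower t t0t.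
have Ft : energy t - ipX xs xs / 2 * S t - C * I t <= F T2 := F_le t T2t.
have CI := ler_wpM2l C0 (IP t T3t).
have g0 := gap_ge0 ipY HY f A b rho ls xs rho_gt0 ls_mult (xhat t).
have a1 : 0 <= t ^+ 2 * xi t * gap (xhat t).
  exact: mulr_ge0 (mulr_ge0 (sqr_ge0 t) (ltW (xi_gt0 t t0t))) g0.
have a3 : 0 <= 2^-1 * ipX (v t) (v t) by rewrite mulr_ge0 ?ip_ge0.
have a4 : 0 <= k2 / 2 * ipX (x t - xs) (x t - xs).
  by rewrite mulr_ge0 ?ip_ge0 // divr_ge0 // ltW // k2_gt0.
have main : S t * (ipX (x t) (x t) - ipX xs xs) <= S t * (2 * (C + 1) * s).
  by lra.
rewrite ler_pM2l ?(lt_le_trans ltr01) // in main.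
rewrite /s mulrC divfK ?gt_eqF ?mulr_gt0 ?ltr_wpDl // in main.
rewrite -(@ler_pXn2r _ 2) ?nnegrE ?addr_ge0 ?(ltW tau0) // HX.
have : 0 <= `|xs| * tau by rewrite mulr_ge0 // ltW.
have := HX xs; nra.
Qed.

End Energy.

(** * Convergence to the minimum-norm solution *)

Lemma near_pinfty_geP (R : realType) (P : R -> Prop) :
  (\forall t \near +oo, P t) <-> exists T, forall t, T <= t -> P t.
Proof.
split=> [[T [Tr TP]]|[T TP]]; last by near=> t; apply: TP; near: t;
  exact: nbhs_pinfty_ge (num_real _).
by exists (T + 1) => t Tt; apply: TP; apply: lt_le_trans Tt; rewrite ltrDl.
Unshelve. all: by end_near. Qed.

(** For [gamma > 0] the square stays bounded while the right side grows linearly. For [gamma = 0]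
    the right side is a constant multiple of [beta] and the square is of order [beta^2 / t^2]. *)
Lemma beta_fun_large (R : realType) (alpha gamma beta M : R) :
  3 < alpha -> 1 < M -> 0 < gamma \/ gamma = 0 /\ 0 <= beta ->
  exists T, forall t, T <= t -> 0 <= Defs.beta_fun gamma beta t /\
    (alpha * Defs.beta_fun gamma beta t / 3 - t * (- beta / t ^+ 2)) ^+ 2
      <= 4 * (alpha / 3 - 1) * (t * Defs.beta_fun gamma beta t) * (1 - M^-1).
Proof.
move=> a3 M1 gb; set k := 4 * (alpha / 3 - 1); set m := 1 - M^-1.
have k0 : 0 < k by rewrite /k; lra.
have m0 : 0 < m by rewrite subr_gt0 invf_lt1 // (lt_trans ltr01).
have km0 : 0 < k * m by rewrite mulr_gt0.
have E t : 0 < t -> alpha * Defs.beta_fun gamma beta t / 3 - t * (- beta / t ^+ 2)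
    = alpha / 3 * gamma + (alpha / 3 + 1) * (beta / t).
  by move=> t0; rewrite /Defs.beta_fun; field; rewrite gt_eqF.
case: gb => [g0|[gE b0]].
  pose K := alpha / 3 * gamma + (alpha / 3 + 1) * (gamma / 2).
  exists (Num.max 1 (Num.max (2 * `|beta| / gamma) (2 * K ^+ 2 / (k * m * gamma)))).
  move=> t; rewrite !ge_max => /and3P[t1 tb tK].
  have t0 : 0 < t by exact: lt_le_trans t1.
  have kmg0 := mulr_gt0 km0 g0.
  rewrite ler_pdivrMr // in tb; rewrite ler_pdivrMr // in tK.
  have : `|beta / t| <= gamma / 2.
    by rewrite normrM normfV (gtr0_norm t0) ler_pdivrMr //; lra.
  rewrite ler_norml => /andP[b1 b2].
  have be2 : gamma / 2 <= Defs.beta_fun gamma beta t by rewrite /Defs.beta_fun; lra.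
  split; first by apply: le_trans be2; rewrite divr_ge0 // ltW.
  rewrite (E t t0); move: (beta / t) b1 b2 => z b1 b2.
  set c := alpha / 3 * gamma + _.
  have : 0 <= (alpha / 3 - 1) * gamma by rewrite mulr_ge0 ?(ltW g0) //; lra.
  have : 0 <= (alpha / 3 + 1) * (z + gamma / 2) by rewrite mulr_ge0 //; lra.
  have : 0 <= (alpha / 3 + 1) * (gamma / 2 - z) by rewrite mulr_ge0 //; lra.
  move=> h1 h2 h3; have c0 : 0 <= c by rewrite /c; lra.
  have cK : c <= K by rewrite /c /K; lra.
  have c2 : c ^+ 2 <= K ^+ 2 by rewrite lerXn2r ?nnegrE // (le_trans c0).
  apply: le_trans c2 _.
  have := ler_wpM2l (ltW (mulr_gt0 km0 t0)) be2; lra.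
(* One factor [beta] is left out of the threshold, so that [beta = 0] needs no separate case. *)
pose K := (alpha / 3 + 1) ^+ 2 * beta.
exists (Num.max 1 (K / (k * m))) => t; rewrite ge_max => /andP[t1 tK].
have t0 : 0 < t by exact: lt_le_trans t1.
rewrite ler_pdivrMr // in tK.
split; first by rewrite /Defs.beta_fun gE add0r divr_ge0 // ltW.
rewrite (E t t0) /Defs.beta_fun gE !(add0r, mulr0) mulrA expr_div_n.
rewrite ler_pdivrMr ?exprn_gt0 // [t * _]mulrC divfK ?gt_eqF //.
have t2 : t <= t ^+ 2 by rewrite expr2 ler_peMl // ltW.
have := ler_wpM2l b0 tK; have := ler_wpM2l (mulr_ge0 b0 (ltW km0)) t2.
by rewrite /K exprMn; lra.
Qed.

Theorem theorem3 (R : realType) (X Y : completeNormedModType R)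
  (ipX : {dot X for idfun}) (ipY : {dot Y for idfun})
  (HX : hilbert_ip ipX) (HY : hilbert_ip ipY)
  (f : X -> R) (gradf : X -> X)
  (fconvex : convex_function [set: X] f)
  (fgrad : is_gradient ipX f gradf) (gradf_cont : continuous gradf)
  (A : {linear X -> Y}) (A_cont : continuous A)
  (AT : Y -> X) (AT_adj : is_adjoint ipX ipY A AT)
  (b : Y) (Omega_neq0 : saddle_points ipY f A b !=set0)
  (rho t0 alpha gamma beta : R)
  (rho_gt0 : 0 < rho) (t0_gt0 : 0 < t0) (alpha_gt3 : 3 < alpha)
  (gamma_beta : 0 < gamma \/ gamma = 0 /\ 0 <= beta)
  (xi : R -> R)
  (xi_gt0 : forall t, t0 <= t -> 0 < xi t)
  (xi_diff : forall t, t0 <= t -> derivable_on `[t0, +oo[ xi t)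
  (xi_growth : exists t1 delta : R, [/\ t0 <= t1, 0 < delta &
     forall t, t1 <= t ->
       (2 - 2 * alpha / 3) + t * (derive_on `[t0, +oo[ xi t / xi t) < - delta])
  (eps : R -> R)
  (eps_ge0 : forall t, t0 <= t -> 0 <= eps t)
  (eps_C1 : C1_on `[t0, +oo[ eps)
  (eps_noninc : forall s t, t0 <= s -> s <= t -> eps t <= eps s)
  (eps_lim : eps t @[t --> +oo] --> 0)
  (eps_decay : exists M t1 : R, [/\ 1 < M, t0 <= t1 &
     forall t, t1 <= t ->
       2 * derive_on `[t0, +oo[ eps t
         + M * `|gamma + beta / t| * xi t * eps t ^+ 2 <= 0])
  (int_finite :
     (\int[lebesgue_measure]_(t in `[t0, +oo[) (xi t * eps t / t)%:E < +oo)%E)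
  (t2xieps_lim : t ^+ 2 * xi t * eps t @[t --> +oo] --> +oo)
  (xi_liminf : limf_einf (fun t => (xi t)%:E) (+oo : set_system R) <> 0%E)
  (avg_lim : (t ^+ 2 * xi t * eps t)^-1
      * (\int[lebesgue_measure]_(s in `[t0, t]) (s ^+ 2 * xi s ^+ 2 * eps s ^+ 2))
      @[t --> +oo] --> 0)
  (x : R -> X) (l : R -> Y)
  (sol : is_PDDS_solution gradf A AT b rho t0 alpha gamma beta xi eps x l)
  (xstar : X) (xstar_proj : is_proj (solution_set f A b) 0 xstar) :
  limf_einf (fun t => `|x t - xstar|%:E) (+oo : set_system R) = 0%E /\
  ((exists T : R, t0 <= T /\
      ((forall t, T <= t -> ball (0 : X) `|xstar| (x t)) \/
       (forall t, T <= t -> (~` ball (0 : X) `|xstar|) (x t)))) ->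
   `|x t - xstar| @[t --> +oo] --> 0).
Proof.
have [xs_sol xs_proj] := xstar_proj.
have xs_min y : solution_set f A b y -> `|xstar| <= `|y|.
  by move=> /xs_proj; rewrite !sub0r !normrN.
have [ls ls_mult] := saddle_multiplier ipY HY f A b xstar Omega_neq0 xs_sol.
have [ddx_ok ddl_ok ode] := sol.
have itv t : t0 <= t -> `[t0, +oo[%classic t by rewrite /= in_itv /= andbT.
have itvD t : `[t0, +oo[%classic t -> t0 <= t by rewrite /= in_itv /= andbT.
have xi_der t (t0t : t0 < t) := is_derive_derive_on _ _ _ _ _ t0t (xi_diff t (ltW t0t)).
have eps_der t (t0t : t0 < t) :=
  is_derive_derive_on _ _ _ _ _ t0t (eps_C1.1 t (itv t (ltW t0t))).
have x_der t (t0t : t0 < t) :=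
  is_derive_derive_on _ _ _ _ _ t0t (ddx_ok t (itv t (ltW t0t))).1.
have dx_der t (t0t : t0 < t) :=
  is_derive_derive_on _ _ _ _ _ t0t (ddx_ok t (itv t (ltW t0t))).2.
have l_der t (t0t : t0 < t) :=
  is_derive_derive_on _ _ _ _ _ t0t (ddl_ok t (itv t (ltW t0t))).1.
have dl_der t (t0t : t0 < t) :=
  is_derive_derive_on _ _ _ _ _ t0t (ddl_ok t (itv t (ltW t0t))).2.
have ode1 t (t0t : t0 < t) := (ode t (ltW t0t)).1.
have ode2 t (t0t : t0 < t) := (ode t (ltW t0t)).2.
have xi_pos t (t0t : t0 < t) := xi_gt0 t (ltW t0t).
have eps_nneg t (t0t : t0 < t) := eps_ge0 t (ltW t0t).
have [M [Td [M1 t0Td decay]]] := eps_decay.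
have [Tg [delta [t0Tg delta0 growth]]] := xi_growth.
have [Tb large] := beta_fun_large R alpha gamma beta M alpha_gt3 M1 gamma_beta.
have [c [Tc [c0 xi_c]]] := liminf_neq0_bounded_below xi t0 xi_gt0 xi_liminf.
(* The entry [t0 + 1] keeps [T1] strictly inside the half-line, where derivatives are two-sided. *)
pose T1 := Num.max (t0 + 1) (Num.max (Num.max Td Tg) (Num.max Tb Tc)).
have T1P t : T1 <= t -> [/\ t0 < t, Td <= t, Tg <= t, Tb <= t & Tc <= t].
  rewrite !ge_max => /andP[t1 /andP[/andP[-> ->] /andP[-> ->]]]; split => //.
  by apply: lt_le_trans t1; rewrite ltrDl.
have t0T1 : t0 < T1 by have [] := T1P T1 (lexx _).
have be_ge0 t : T1 <= t -> 0 <= Defs.beta_fun gamma beta t.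
  by move=> /T1P [_ _ _ /large [] ].
have be_large t (T1t : T1 <= t) := let: And5 _ _ _ h _ := T1P t T1t in (large t h).2.
have be_le t : T1 <= t -> Defs.beta_fun gamma beta t <= `|gamma| + `|beta| / t0.
  move=> /T1P [t0t _ _ _ _]; rewrite /Defs.beta_fun.
  have tp : 0 < t by exact: lt_trans t0t.
  apply: le_trans (ler_norm _) _; apply: le_trans (ler_normD _ _) _.
  rewrite lerD2l normrM normfV (gtr0_norm tp) ler_wpM2l //.
  by rewrite lef_pV2 ?posrE // ltW.
have growth' t : T1 <= t ->
    2 * t * xi t + t ^+ 2 * derive_on `[t0, +oo[ xi t <= 2 * alpha / 3 * t * xi t.
  move=> /T1P [t0t _ /growth g _ _].
  have xip := xi_pos t t0t; have tp : 0 < t by exact: lt_trans t0t.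
  have := ler_wpM2r (ltW (mulr_gt0 tp xip)) (ltW g).
  have -> : (2 - 2 * alpha / 3 + t * (derive_on `[t0, +oo[ xi t / xi t)) * (t * xi t)
    = 2 * t * xi t + t ^+ 2 * derive_on `[t0, +oo[ xi t - 2 * alpha / 3 * t * xi t.
    by field; rewrite gt_eqF.
  have := mulr_gt0 delta0 (mulr_gt0 tp xip); lra.
have decay' t : T1 <= t ->
    2 * derive_on `[t0, +oo[ eps t
      + M * Defs.beta_fun gamma beta t * xi t * eps t ^+ 2 <= 0.
  move=> T1t; have [_ /decay + _ _ _] := T1P t T1t.
  by have := be_ge0 t T1t; rewrite /Defs.beta_fun => /ger0_norm ->.
have xi_c' t : T1 <= t -> c <= xi t by move=> /T1P [_ _ _ _ /xi_c].
have xi_cont := derivable_on_within_continuous _ _ _ xi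
  (fun t Dt => xi_diff t (itvD t Dt)).
have eps_cont := derivable_on_within_continuous _ _ _ eps eps_C1.1.
have id_cont : {within `[t0, +oo[, continuous (@id R)}.
  by apply: continuous_subspaceT => t; exact: cvg_id.
have J_cont : {within `[t0, +oo[, continuous (fun t => xi t * eps t / t)}.
  apply/subspace_continuousP => t Dt; apply: cvgM; last apply: cvgV.
  - by apply: cvgM; [move/subspace_continuousP: xi_cont|
                     move/subspace_continuousP: eps_cont]; apply.
  - by rewrite gt_eqF // (lt_le_trans t0_gt0) // itvD.
  - by move/subspace_continuousP: id_cont; apply.
have I_cont : {within `[t0, +oo[, continuous
    (fun t => t ^+ 2 * xi t ^+ 2 * eps t ^+ 2)}.
  apply/subspace_continuousP => t Dt.
  have h1 : s @[s --> within `[t0, +oo[%classic (nbhs t)] --> t.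
    by apply: cvg_within_filter; exact: cvg_id.
  move/subspace_continuousP: xi_cont => /(_ t Dt) h2.
  move/subspace_continuousP: eps_cont => /(_ t Dt) h3.
  by apply: cvgM; [apply: cvgM|]; exact: cvgM.
have J_ge0 t : t0 <= t -> 0 <= xi t * eps t / t.
  move=> t0t; rewrite divr_ge0 ?mulr_ge0 ?eps_ge0 ?(ltW (xi_gt0 t t0t)) //.
  by rewrite (le_trans (ltW t0_gt0)).
have [BJ J_le] := Rintegral_bounded _ _ J_cont J_ge0 int_finite.
have J_der t (t0t : t0 < t) := is_derive_Rintegral _ _ _ J_cont t0t.
have I_der t (t0t : t0 < t) := is_derive_Rintegral _ _ _ I_cont t0t.
have close := norm_le_close ipX ipY HX HY f gradf fconvex fgrad A AT b A_cont AT_adj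
  rho ls xstar rho_gt0 xs_sol ls_mult t0 alpha gamma beta t0_gt0 alpha_gt3 _ _ _ _
  _ _ _ _ _ _ xi_pos eps_nneg xi_der eps_der x_der dx_der l_der dl_der ode1 ode2
  M T1 _ c M1 t0T1 be_ge0 be_le be_large growth' decay' c0 xi_c' xs_min
  _ BJ J_der (fun t _ => J_le t).
have outside := norm_le_of_outside ipX ipY HX HY f gradf fconvex fgrad A AT b A_cont
  AT_adj rho ls xstar rho_gt0 xs_sol ls_mult t0 alpha gamma beta t0_gt0 alpha_gt3 _ _ _ _
  _ _ _ _ _ _ xi_pos eps_nneg xi_der eps_der x_der dx_der l_der dl_der ode1 ode2
  M T1 _ M1 t0T1 be_ge0 be_le be_large growth' decay' _ I_der.
have Sy K : exists T, forall t, T <= t -> K <= t ^+ 2 * xi t * eps t.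
  by apply/near_pinfty_geP; move/cvgryPge: t2xieps_lim; apply.
have IS e : 0 < e -> exists T, forall t, T <= t ->
    \int[lebesgue_measure]_(s in `[t0, t]) (s ^+ 2 * xi s ^+ 2 * eps s ^+ 2)
    <= e * (t ^+ 2 * xi t * eps t).
  move=> e0; have [Ta avgT] := (near_pinfty_geP _ _).1 (cvgr_le _ avg_lim e e0).
  (* Beyond [Ts] the denominator in [avg_lim] is at least 1, so it may be multiplied out. *)
  have [Ts ST] := Sy 1; exists (Num.max Ta Ts) => t; rewrite ge_max => /andP[Tat Tst].
  have := avgT t Tat; have /(lt_le_trans ltr01) S0 := ST t Tst.
  by rewrite ler_pdivrMl // mulrC.
have lim_of_norm : (forall tau, 0 < tau -> exists T, forall t, T <= t ->
    `|x t| <= `|xstar| + tau) -> `|x t - xstar| @[t --> +oo] --> 0.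
  move=> small; apply/cvgr0Pnorm_lt => e e0; apply/near_pinfty_geP.
  have [tau tau0 [T _ TP]] := close e e0; have [T' T'P] := small tau tau0.
  exists (Num.max T T') => t; rewrite ge_max => /andP[Tt T't].
  by rewrite normr_id; apply: TP => //; exact: T'P.
have lim_outside : (exists T, forall t, T <= t -> `|xstar| <= `|x t|) ->
    `|x t - xstar| @[t --> +oo] --> 0.
  by move=> out; apply: lim_of_norm; exact: outside IS Sy out.
split; last first.
  move=> [T [_ [inside|out]]].
    apply: lim_of_norm => tau tau0; exists T => t /inside.
    rewrite -ball_normE /= sub0r normrN => /ltW h.
    by apply: le_trans h _; rewrite lerDl ltW.
  apply: lim_outside; exists T => t /out; rewrite -ball_normE /= sub0r normrN.
  by move/negP; rewrite -leNgt.
apply: (limf_einf_eq0 _ t0) => // e T e0.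
(* Either the trajectory is eventually outside the open ball and converges, or it is inside at
   arbitrarily late times, where [close] applies. *)
have [out|/forallNP noout] := pselect (exists T, forall t, T <= t -> `|xstar| <= `|x t|).
  move/cvgr0Pnorm_lt: (lim_outside out) => /(_ e e0) /near_pinfty_geP [T' T'P].
  exists (Num.max T T'); first by rewrite le_max lexx.
  by have := T'P (Num.max T T'); rewrite normr_id; apply; rewrite le_max lexx orbT.
have [tau tau0 [T' _ T'P]] := close e e0.
have /existsNP[t /not_implyP[+ /negP]] := noout (Num.max T T').
rewrite ge_max -ltNge => /andP[Tt T't] xt; exists t => //; apply: T'P => //.
by apply: le_trans (ltW xt) _; rewrite lerDl ltW.
Qed.
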